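(* Let $G(\lambda)\in\mathbb{C}(\lambda)^{r\times r}$ be a rational matrix with a $T$-even realization $G(\lambda)=D(\lambda)+B^TA(\lambda)^{-1}B$, i.e. $A(\lambda)=\sum_{j=0}^m\lambda^jA_j\in\mathbb{C}[\lambda]^{n\times n}$ is regular of degree $m$, $D(\lambda)=\sum_{j=0}^k\lambda^jD_j\in\mathbb{C}[\lambda]^{r\times r}$ has degree $k$, $A(\lambda)$ and $D(\lambda)$ are $T$-even, and $B\in\mathbb{C}^{n\times r}$; let $\mathcal{S}(\lambda)=\begin{bmatrix}A(\lambda)&B\\ B^T&D(\lambda)\end{bmatrix}$ be the corresponding system matrix. Let $h\in\{0,1,\dots,m-1\}$ be even, let $w$ be the simple admissible tuple of $\{0,1,\dots,h\}$ and $c_w$ its symmetric complement. Let $z_h+m$ be an admissible tuple of $\{0,1,\dots,m-h-1\}$ and $c_{z_h}+m$ the symmetric complement of $z_h+m$. Similarly, let $\ell\in\{0,1,\dots,k-1\}$ be even, let $v$ be the simple admissible tuple of $\{0,1,\dots,\ell\}$ and $c_v$ its symmetric complement. Let $z_\ell+k$ be an admissible tuple of $\{0,1,\dots,k-\ell-1\}$ and $c_{z_\ell}+k$ the symmetric complement of $z_\ell+k$. Put $L_A(\lambda)=(\lambda M^A_{z_h}-M^A_w)M^A_{c_w}M^A_{c_{z_h}}$ and $L_D(\lambda)=(\lambda N^D_{z_\ell}-N^D_v)N^D_{c_v}N^D_{c_{z_\ell}}$. Then there exist unique quasi-identity matrices $Q_A\in\mathbb{C}^{mn\times mn}$ and $Q_D\in\mathbb{C}^{kr\times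 kr}$ such that $$\mathbb{L}(\lambda)=\left[\begin{array}{c|c} Q_AL_A(\lambda) & e_{m-i_0(w)}e^T_{k-c_0(v,c_v)}\otimes B\\ \hline e_{k-i_0(v)}e^T_{m-c_0(w,c_w)}\otimes B^T & Q_DL_D(\lambda)\end{array}\right]$$ is $T$-even. Moreover, when the leading coefficient of $A(\lambda)$ is singular, assume $\mathrm{Ind}(z_h+m)=0$, and when the leading coefficient of $D(\lambda)$ is singular, assume $\mathrm{Ind}(z_\ell+k)=0$. Then $\mathbb{L}(\lambda)$ is a Rosenbrock linearization of $G(\lambda)$.
   Context: A matrix polynomial (or pencil, or rational matrix) $P(\lambda)$ is $T$-even if $P(-\lambda)^T=P(\lambda)$. Elementary matrices. For $P\in\mathbb{C}^{n\times n}$ define $mn\times mn$ matrices $M_0(P)=\mathrm{diag}(I_{(m-1)n},P)$, $M_{-m}(P)=\mathrm{diag}(P,I_{(m-1)n})$, and for $i=1,\dots,m-1$: $M_i(P)=\mathrm{diag}\left(I_{(m-i-1)n},\begin{bmatrix}P&I_n\\ I_n&0\end{bmatrix},I_{(i-1)n}\right)$, $M_{-i}(P)=\mathrm{diag}\left(I_{(m-i-1)n},\begin{bmatrix}0&I_n\\ I_n&P\end{bmatrix},I_{(i-1)n}\right)$. Set $M_i^A=M_i(-A_i)$ for $i=0,\dots,m-1$ and $M_i^A=M_i(A_{-i})$ for $i=-1,\dots,-m$. The $kr\times kr$ matrices $N_i(P)$ and $N_i^D$ are defined in the same way with $(m,n,A)$ replaced by $(k,r,D)$. For a tuple $p=(p_1,\dots,p_s)$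 of integers, $M^A_p=M^A_{p_1}\cdots M^A_{p_s}$ and $N^D_p=N^D_{p_1}\cdots N^D_{p_s}$ (identity if $p$ is empty). A permutation of a finite set is viewed as a tuple listing each element exactly once; $(s,t)$ denotes concatenation of tuples, $t+j$ adds $j$ to each entry, and $(a:b)=(a,a+1,\dots,b)$. Column standard form. For a permutation $\gamma$ of $\{0,\dots,p\}$, $\mathrm{csf}(\gamma)$ is the unique tuple of the form $(m_q:n_q,\,m_{q-1}:n_{q-1},\dots,m_1:n_1)$ with $0\le n_1<\dots<n_q\le p$ and $0\le m_i\le n_i$ that can be obtained from $\gamma$ by repeatedly interchanging adjacent entries $i,j$ with $|i-j|>1$. Admissible tuples. Let $p\ge0$. An admissible tuple of $\{0,\dots,p\}$ is a permutation $\gamma$ of $\{0,\dots,p\}$ with $\mathrm{csf}(\gamma)=(p-1:p,\,p-3:p-2,\dots,q+1:q+2,\,0:q)$ for some $0\le q\le p$; $q=\mathrm{Ind}(\gamma)$ is its index. It is simple if $q\in\{0,1\}$. Its symmetric complement is $c_\gamma=(p-1,p-3,\dots,q+3,q+1,(0:q)_{\mathrm{rev}_c})$ if $q\ge1$, where $(0:q)_{\mathrm{rev}_c}=(0:q-1,0:q-2,\dots,0:1,0)$; $c_\gamma=(p-1,p-3,\dots,1)$ if $q=0$ and $p>0$; and $c_\gamma=\emptyset$ if $p=0$. Consecutions and inversions. A subtuple is obtained by deleting some (possibly no) entries, keeping the order. For a tuple $\gamma$ of nonnegative integers containing $0$, $c_0(\gamma)$ is the largest $s$ such that $(0,1,\dots,s)$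 is a subtuple of $\gamma$, and $i_0(\gamma)$ is the largest $s$ such that $(s,\dots,1,0)$ is a subtuple of $\gamma$. A quasi-identity matrix in $\mathbb{C}^{mn\times mn}$ is $\epsilon_1I_n\oplus\dots\oplus\epsilon_mI_n$ with $\epsilon_i\in\{1,-1\}$; in $\mathbb{C}^{kr\times kr}$ it is $\epsilon_1I_r\oplus\dots\oplus\epsilon_kI_r$ with $\epsilon_i\in\{1,-1\}$. $e_j$ denotes the $j$-th standard basis (column) vector, of $\mathbb{C}^m$ when written $e_{m-\cdot}$ and of $\mathbb{C}^k$ when written $e_{k-\cdot}$; $\otimes$ is the Kronecker product. Rosenbrock linearization. A pencil $\mathbb{L}(\lambda)$ of size $mn+kr$ is a Rosenbrock linearization of $G(\lambda)$, with system matrix $\mathcal{S}(\lambda)$, if there are unimodular matrix polynomials $U_A,V_A$ of size $mn$ and $U_D,V_D$ of size $kr$ with $\mathrm{diag}(U_A,U_D)\,\mathbb{L}\,\mathrm{diag}(V_A,V_D)=\mathrm{diag}(I_{(m-1)n},\mathcal{S},I_{(k-1)r})$.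
   Formalization: Q_A and Q_D are proved unique only up to multiplication of each by −1 (strict uniqueness fails, since −Q_A or −Q_D also keeps the pencil T-even), and the Rosenbrock linearization claim is proved for one suitable choice of these signs. *)

(* Defs.v *)
From HB Require Import structures.
From mathcomp Require Import all_boot all_order all_algebra.
From mathcomp Require Import reals.
From mathcomp.real_closed Require Import complex mxtens.

Set Implicit Arguments.
Unset Strict Implicit.
Unset Printing Implicit Defensive.

Import Order.TTheory GRing.Theory Num.Theory.
Local Open Scope ring_scope.

(* ---------- Tuples of integers ---------- *)

(* (a : b) = (a, a+1, ..., b), for a <= b. *)
Definition range (a b : nat) : seq int := [seq Posz i | i <- iota a (b.+1 - a)].

(* t + j *)
Definition shift (t : seq int) (j : int) : seq int := [seq x + j | x <- t].

(* t can be obtained from s by repeatedly interchanging adjacent entries i, j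
   with |i - j| > 1. *)
Inductive swap_equiv : seq int -> seq int -> Prop :=
| swap_refl (t : seq int) : swap_equiv t t
| swap_step (s1 s2 t : seq int) (i j : int) :
    1 < `|i - j| ->
    swap_equiv (s1 ++ j :: i :: s2) t -> swap_equiv (s1 ++ i :: j :: s2) t.

(* c = (m_q : n_q, ..., m_1 : n_1) with 0 <= n_1 < ... < n_q <= p and
   0 <= m_i <= n_i; s lists the pairs (m_q, n_q), ..., (m_1, n_1). *)
Definition csf_form (p : nat) (c : seq int) : Prop :=
  exists s : seq (nat * nat),
    [/\ all (fun x => x.1 <= x.2 <= p)%N s,
        sorted (fun x y => y.2 < x.2)%N s
      & c = flatten [seq range x.1 x.2 | x <- s]].

(* c = csf(g), for a permutation g of {0, ..., p}. *)
Definition is_csf (p : nat) (g c : seq int) : Prop :=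
  csf_form p c /\ swap_equiv g c.

(* (p-1 : p, p-3 : p-2, ..., q+1 : q+2, 0 : q), for q <= p with p - q even. *)
Definition admissible_csf (p q : nat) : seq int :=
  flatten [seq range (q + 2 * i + 1) (q + 2 * i + 2)
            | i <- rev (iota 0 (p - q)./2)] ++ range 0 q.

(* g is an admissible tuple of {0, ..., p} and q = Ind(g). *)
Definition admissible (p : nat) (g : seq int) (q : nat) : Prop :=
  [/\ perm_eq g (range 0 p), (q <= p)%N, ~~ odd (p - q)
    & is_csf p g (admissible_csf p q)].

Definition simple_admissible (p : nat) (g : seq int) (q : nat) : Prop :=
  admissible p g q /\ (q = 0%N \/ q = 1%N).

(* (0 : q)_{rev_c} = (0 : q-1, 0 : q-2, ..., 0 : 1, 0); empty for q = 0. *)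
Definition rev_c (q : nat) : seq int :=
  flatten [seq range 0 j | j <- rev (iota 0 q)].

(* The symmetric complement (p-1, p-3, ..., q+1, (0 : q)_{rev_c}) of an
   admissible tuple of {0, ..., p} of index q.  For q = 0 this is
   (p-1, p-3, ..., 1), which is empty if moreover p = 0. *)
Definition symm_compl (p q : nat) : seq int :=
  [seq Posz (q + 2 * i + 1) | i <- rev (iota 0 (p - q)./2)] ++ rev_c q.

(* The bound s < size g loses nothing: (0, ..., s) has s + 1 entries. *)
Definition c0 (g : seq int) : nat :=
  (\max_(s < size g | subseq (range 0 s) g) s)%N.

Definition i0 (g : seq int) : nat :=
  (\max_(s < size g | subseq (rev (range 0 s)) g) s)%N.

(* ---------- Matrix polynomials ---------- *)

Section MatrixPolynomials.
Variable F : fieldType.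

Definition mxcoef (m n : nat) (P : 'M[{poly F}]_(m, n)) (j : nat) :
  'M[F]_(m, n) := map_mx (coefp j) P.

Definition mxdegree (m n : nat) (P : 'M[{poly F}]_(m, n)) (d : nat) : Prop :=
  (forall j, (d < j)%N -> mxcoef P j = 0) /\ mxcoef P d != 0.

Definition is_pencil (m n : nat) (P : 'M[{poly F}]_(m, n)) : Prop :=
  forall j, (1 < j)%N -> mxcoef P j = 0.

Definition regular (n : nat) (P : 'M[{poly F}]_n) : bool := \det P != 0.

Definition T_even (n : nat) (P : 'M[{poly F}]_n) : Prop :=
  (map_mx (fun p => p \Po (- 'X)) P)^T = P.

(* Constant matrices seen as matrix polynomials. *)
Definition cmx (m n : nat) (P : 'M[F]_(m, n)) : 'M[{poly F}]_(m, n) :=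
  map_mx polyC P.

(* Polynomial matrices seen as rational matrices. *)
Definition ratmx (m n : nat) (P : 'M[{poly F}]_(m, n)) :
  'M[{fraction {poly F}}]_(m, n) := map_mx (@tofrac {poly F}) P.

(* G = D + B^T A^-1 B *)
Definition realization (n r : nat) (G : 'M[{fraction {poly F}}]_r)
    (A : 'M[{poly F}]_n) (B : 'M[F]_(n, r)) (D : 'M[{poly F}]_r) : Prop :=
  G = ratmx D + (ratmx (cmx B))^T *m invmx (ratmx A) *m ratmx (cmx B).

Definition system_matrix (n r : nat)
    (A : 'M[{poly F}]_n) (B : 'M[F]_(n, r)) (D : 'M[{poly F}]_r) :
    'M[{poly F}]_(n + r) :=
  block_mx A (cmx B) (cmx B^T) D.

(* ---------- Elementary matrices ---------- *)

(* The (m n) x (m n) matrix with n x n blocks E a b, 0 <= a, b < m; blocks are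
   numbered from 0, and indexed as in the Kronecker product tensmx. *)
Definition blocks_mx (m n : nat) (E : nat -> nat -> 'M[F]_n) : 'M[F]_(m * n) :=
  \matrix_(x, y) E (mxtens_unindex x).1 (mxtens_unindex y).1
                   (mxtens_unindex x).2 (mxtens_unindex y).2.

(* M_i(P), for -m <= i <= m - 1.  For 0 < |i| < m the distinguished 2 x 2 array
   of blocks, preceded by I_{(m-|i|-1)n}, occupies the block rows and columns
   p = m - |i| - 1 and p + 1. *)
Definition elem_mx (m n : nat) (i : int) (P : 'M[F]_n) : 'M[F]_(m * n) :=
  blocks_mx m (fun a b : nat =>
    let p := (m - absz i - 1)%N in
    if i == 0 then
      if (a == m.-1) && (b == m.-1) then P else (a == b)%:R%:M
    else if i == - (m%:Z) then
      if (a == 0%N) && (b == 0%N) then P else (a == b)%:R%:M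
    else if (a == p) && (b == p) then if 0 < i then P else 0
    else if (a == p.+1) && (b == p.+1) then if 0 < i then 0 else P
    else if (a == p) && (b == p.+1) || (a == p.+1) && (b == p) then 1%:M
    else (a == b)%:R%:M).

(* M^A_i *)
Definition elem_coef_mx (m n : nat) (A : 'M[{poly F}]_n) (i : int) :
    'M[F]_(m * n) :=
  elem_mx m i (if 0 <= i then - mxcoef A (absz i) else mxcoef A (absz i)).

(* M^A_t, for a tuple t *)
Definition tuple_mx (m n : nat) (A : 'M[{poly F}]_n) (t : seq int) :
    'M[F]_(m * n) :=
  \big[mulmx/1%:M]_(i <- t) elem_coef_mx m A i.

(* (lambda M^A_z - M^A_w) M^A_{c_w} M^A_{c_z} *)
Definition fiedler_pencil (m n : nat) (A : 'M[{poly F}]_n)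
    (z w cw cz : seq int) : 'M[{poly F}]_(m * n) :=
  ('X *: cmx (tuple_mx m A z) - cmx (tuple_mx m A w))
    *m cmx (tuple_mx m A cw) *m cmx (tuple_mx m A cz).

Definition quasi_identity (m n : nat) (Q : 'M[F]_(m * n)) : Prop :=
  exists eps : 'rV[F]_m,
    (forall i, eps 0 i = 1 \/ eps 0 i = -1) /\
    Q = diag_mx eps *t (1%:M : 'M[F]_n).

(* e_j, with 1 <= j <= m *)
Definition ecol (m j : nat) : 'cV[F]_m := \col_(i < m) (i.+1 == j)%:R.

(* ---------- The pencil and Rosenbrock linearizations ---------- *)

Definition ros_pencil (m n k r : nat) (B : 'M[F]_(n, r))
    (w cw v cv : seq int)
    (QA : 'M[F]_(m * n)) (LA : 'M[{poly F}]_(m * n))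
    (QD : 'M[F]_(k * r)) (LD : 'M[{poly F}]_(k * r)) :
    'M[{poly F}]_(m * n + k * r) :=
  block_mx
    (cmx QA *m LA)
    (cmx ((ecol m (m - i0 w) *m (ecol k (k - c0 (v ++ cv)))^T) *t B))
    (cmx ((ecol k (k - i0 v) *m (ecol m (m - c0 (w ++ cw)))^T) *t B^T))
    (cmx QD *m LD).

(* diag(I_{(m-1)n}, S, I_{(k-1)r}) has size (m-1)n + ((n+r) + (k-1)r), which
   equals mn + kr only propositionally (for m, k > 0); hence the cast.
   Unimodular matrix polynomials are the units of the ring of square matrix
   polynomials. *)
Definition rosenbrock_linearization (m n k r : nat)
    (G : 'M[{fraction {poly F}}]_r)
    (A : 'M[{poly F}]_n) (B : 'M[F]_(n, r)) (D : 'M[{poly F}]_r)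
    (L : 'M[{poly F}]_(m * n + k * r)) : Prop :=
  [/\ realization G A B D, is_pencil L &
    exists UA VA : 'M[{poly F}]_(m * n), exists UD VD : 'M[{poly F}]_(k * r),
      [/\ UA \in unitmx, VA \in unitmx, UD \in unitmx, VD \in unitmx &
        exists e : (m.-1 * n + ((n + r) + k.-1 * r) = m * n + k * r)%N,
          block_mx UA 0 0 UD *m L *m block_mx VA 0 0 VD =
          castmx (e, e)
            (block_mx (1%:M : 'M_(m.-1 * n)) 0 0
               (block_mx (system_matrix A B D) 0 0 (1%:M : 'M_(k.-1 * r))))]].

End MatrixPolynomials.

(* Main.v *)
Require Import Defs.
From HB Require Import structures.
From mathcomp Require Import all_boot all_order all_algebra.
From mathcomp Require Import reals.
From mathcomp.real_closed Require Import complex mxtens.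
From mathcomp Require Import zify ring.

Set Implicit Arguments.
Unset Strict Implicit.
Unset Printing Implicit Defensive.

Import Order.TTheory GRing.Theory Num.Theory.
Local Open Scope ring_scope.

(** The pencil splits into two independent problems, one for A and one for D:
    each asks for signs that make a block-symmetric pencil T-even, and for
    unimodular matrices that reduce it to diag(I, A) while fixing the block row
    and the block column that carry B.

    Number the blocks from 0 and put c = m-h-1, q = Ind(z_h + m).  As h is even,
    w has index 0, so that M_w and M_z are, up to the allowed interchanges, a
    product of odd-placed factors followed by one of even-placed factors (lemma
    pairs_split).  Factors with disjoint supports commute, and this puts the
    pencil in the form

      L = G T G,    G = M_F M_O,

    where M_F and M_O are the products of the odd-placed factors of z_h and of w.
    These act on disjoint pairs of blocks, hence G is invertible.  The core
    T = X T1 - T0 depends on q and m only (lemmas L1_factor and L0_factor).  Its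
    blocks up to q are block Hankel, since the product over (0:q) followed by its
    reversal is (lemma rev_c_hankel); beyond q it is block tridiagonal, with
    diagonal blocks X a_j + a_(j-1) and 0 in alternation and off-diagonal blocks
    -I and X I in alternation.

    T-evenness.  Transposition together with X -> -X multiplies the block (x, y)
    of T by the product of two signs s_x s_y, read off from the parity of the
    index of the coefficient there.  With S = diag(s) and a second sign matrix Q
    one has G^T S = Q G, so Q L = G^T S T G is T-even (lemmas G_sign, T1_sign,
    T0_sign).

    Uniqueness.  If Q' also works, then P = Q Q' commutes with both coefficients
    of L.  The graph on the blocks in which x and y are joined when L has a
    nonzero block (x, y) is connected: the identity blocks join everything from q
    on, and the leading coefficient a_m, which is nonzero, joins the Hankel part
    to it.  Hence P = 1 or P = -1 (lemma connected).

    Linearization.  There is a block column v, made of powers of X and of partial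
    Horner sums of A, with last block I and T v = e A, where e is the last block
    column of the identity (lemma core_null).  By block symmetry there is a
    similar block row u.  Eliminating with u and v turns T into diag(T', A), where
    T' consists of the blocks below m-1.  Solving for the block rows one at a time
    shows that T' is unimodular; the Hankel part requires a_m to be invertible,
    and is empty when q = 0 (lemma core_minor_unit).  The eliminations fix e, and
    G sends e to the block column that carries B, since i_0(w) = c_0(w, c_w) is 0
    for h = 0 and 1 otherwise.  The overall sign of Q is chosen so that this block
    column keeps its sign.  For D, the first and the last block are exchanged at
    the end, and the pieces are assembled. *)

(** * Block matrices *)

Section Blocks.
Variables (S : comUnitRingType) (m n : nat).
Implicit Types (E : nat -> nat -> 'M[S]_n) (M N : 'M[S]_(m * n)).

Definition blk E : 'M[S]_(m * n) :=
  \matrix_(i, j) E (mxtens_unindex i).1 (mxtens_unindex j).1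
                   (mxtens_unindex i).2 (mxtens_unindex j).2.

(** Matrices are computed through their block rows [Erow x *m M].  The block row
    is defined for every natural number, and vanishes outside the range, which
    removes boundary cases from the row formulas. *)
Definition Erow (x : nat) : 'M[S]_(n, m * n) :=
  \matrix_(i, j) (((mxtens_unindex j).1 == x :> nat)
                  && ((mxtens_unindex j).2 == i))%:R.

Definition Ecol (x : nat) : 'M[S]_(m * n, n) := (Erow x)^T.

Lemma Erow_out x : (m <= x)%N -> Erow x = 0.
Proof.
move=> hx; apply/matrixP=> i j; rewrite !mxE ltn_eqF //.
by apply: leq_trans hx; exact: (ltn_ord (mxtens_unindex j).1).
Qed.

Lemma Erow_mulE x p (M : 'M[S]_(m * n, p)) (hx : (x < m)%N) i j :
  (Erow x *m M) i j = M (mxtens_index (Ordinal hx, i)) j.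
Proof.
rewrite mxE (bigD1 (mxtens_index (Ordinal hx, i))) //= big1 ?addr0.
  by rewrite !mxE mxtens_indexK /= !eqxx mul1r.
move=> k; case: (mxtens_indexP k) => a b hk.
rewrite !mxE mxtens_indexK /=; case: eqP => [ea|_]; last by rewrite mul0r.
case: eqP => [eb|_]; last by rewrite mul0r.
by case/eqP: hk; rewrite eb; congr (mxtens_index (_, _)); apply: val_inj.
Qed.

Lemma eq_rows p (M N : 'M[S]_(m * n, p)) :
  (forall x, (x < m)%N -> Erow x *m M = Erow x *m N) -> M = N.
Proof.
move=> h; apply/matrixP=> i j; case: (mxtens_indexP i) => [[x hx] b].
by have /matrixP/(_ b j) := h x hx; rewrite !Erow_mulE.
Qed.

Lemma Erow_Ecol x y : (x < m)%N -> Erow x *m Ecol y = (x == y)%:R%:M.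
Proof.
move=> hx; apply/matrixP=> i j; rewrite Erow_mulE !mxE mxtens_indexK /=.
by case: (x == y); rewrite ?mul0rn //= mulr1n.
Qed.

Lemma row_blk E x : (x < m)%N ->
  Erow x *m blk E = \sum_(y < m) E x y *m Erow y.
Proof.
move=> hx; apply/matrixP=> i j; case: (mxtens_indexP j) => a b.
rewrite Erow_mulE [LHS]mxE summxE !mxtens_indexK /=.
rewrite (bigD1 a) //= [X in _ + X]big1 ?addr0 => [|k hk].
  rewrite mxE (bigD1 b) //= big1 ?addr0 => [|k hk].
    by rewrite mxE mxtens_indexK /= !eqxx mulr1.
  by rewrite mxE mxtens_indexK /= eqxx eq_sym (negPf hk) mulr0.
rewrite mxE big1 // => l _.
rewrite mxE mxtens_indexK /= eq_sym.
by have /negPf-> : k != a :> nat by []; rewrite mulr0.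
Qed.

Lemma sum_Erow1 (f : nat -> 'M[S]_n) z :
  (forall y, (y < m)%N -> y != z -> f y = 0) ->
  \sum_(y < m) f y *m Erow y = f z *m Erow z.
Proof.
move=> h; case: (ltnP z m) => [hz|hz].
  rewrite (bigD1 (Ordinal hz)) //= big1 ?addr0 // => y hy.
  by rewrite h ?mul0mx.
rewrite (Erow_out hz) mulmx0 big1 // => y _; rewrite h ?mul0mx //.
by rewrite ltn_eqF // (leq_trans _ hz).
Qed.

Lemma sum_Erow2 (f : nat -> 'M[S]_n) z z' : z != z' ->
  (forall y, (y < m)%N -> y != z -> y != z' -> f y = 0) ->
  \sum_(y < m) f y *m Erow y = f z *m Erow z + f z' *m Erow z'.
Proof.
move=> zz' h; pose g w y := if y == w then f y else 0.
have -> : \sum_(y < m) f y *m Erow y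
    = \sum_(y < m) (g z y *m Erow y + g z' y *m Erow y).
  apply: eq_bigr => y _; rewrite -mulmxDl /g; congr (_ *m _).
  case: eqP => [->|/eqP hz]; first by rewrite (negPf zz') addr0.
  by case: eqP => [//|/eqP hz']; rewrite add0r // h.
have e w : \sum_(y < m) g w y *m Erow y = f w *m Erow w.
  by rewrite (@sum_Erow1 (g w) w) /g ?eqxx // => y _ /negPf->.
by rewrite big_split /= !e.
Qed.

Lemma row_blk1 E x z : (x < m)%N ->
  (forall y, (y < m)%N -> y != z -> E x y = 0) ->
  Erow x *m blk E = E x z *m Erow z.
Proof. by move=> hx h; rewrite row_blk // (@sum_Erow1 (E x) z). Qed.

Lemma row_blk2 E x z z' : (x < m)%N -> z != z' ->
  (forall y, (y < m)%N -> y != z -> y != z' -> E x y = 0) ->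
  Erow x *m blk E = E x z *m Erow z + E x z' *m Erow z'.
Proof. by move=> hx hz h; rewrite row_blk // (@sum_Erow2 (E x) z z'). Qed.

Lemma eq_blk E E' : (forall x y, (x < m)%N -> (y < m)%N -> E x y = E' x y) ->
  blk E = blk E'.
Proof. by move=> h; apply/matrixP=> i j; rewrite !mxE h ?ltn_ord. Qed.

Lemma tr_blk E : (blk E)^T = blk (fun a b => (E b a)^T).
Proof. by apply/matrixP=> i j; rewrite !mxE. Qed.

Lemma opp_blk E : - blk E = blk (fun a b => - E a b).
Proof. by apply/matrixP=> i j; rewrite !mxE. Qed.

Definition sgmx (s : nat -> S) : 'M[S]_(m * n) :=
  diag_mx (\row_j s (mxtens_unindex j).1).

Lemma sgmx_blk s E : sgmx s *m blk E = blk (fun a b => s a *: E a b).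
Proof. by apply/matrixP=> i j; rewrite mul_diag_mx !mxE. Qed.

Lemma blk_sgmx s E : blk E *m sgmx s = blk (fun a b => s b *: E a b).
Proof. by apply/matrixP=> i j; rewrite mul_mx_diag !mxE mulrC. Qed.

Lemma tr_sgmx s : (sgmx s)^T = sgmx s.
Proof. exact: tr_diag_mx. Qed.

Lemma row_sgmx s x : Erow x *m sgmx s = s x *: Erow x.
Proof.
apply/matrixP=> i j; rewrite mul_mx_diag !mxE mulrC.
by case: eqP => [->|]; rewrite ?mulr0.
Qed.

Lemma sgmxM s t : sgmx s *m sgmx t = sgmx (fun x => s x * t x).
Proof. by rewrite /sgmx mulmx_diag; congr diag_mx; apply/rowP=> j; rewrite !mxE. Qed.

Lemma sgmx_id s : (forall x, (x < m)%N -> s x = 1) -> sgmx s = 1%:M.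
Proof.
move=> h; rewrite /sgmx -diag_const_mx; congr diag_mx; apply/rowP=> j.
by rewrite !mxE h.
Qed.

Definition supp (P : pred nat) M : Prop :=
  forall i j, ~~ (P (mxtens_unindex i).1 && P (mxtens_unindex j).1) ->
    M i j = (i == j)%:R.

Lemma supp1 P : supp P 1%:M.
Proof. by move=> i j _; rewrite mxE. Qed.

Lemma supp_sub (P Q : pred nat) M :
  (forall x, (x < m)%N -> P x -> Q x) -> supp P M -> supp Q M.
Proof.
move=> sPQ sM i j hQ; apply: sM; apply: contra hQ => /andP[h1 h2].
by rewrite !sPQ ?ltn_ord.
Qed.

Lemma supp_mul P M N : supp P M -> supp P N -> supp P (M *m N).
Proof.
move=> sM sN i j; rewrite negb_and => /orP[hi|hj]; rewrite mxE.
  rewrite (bigD1 i) //= big1 ?addr0 => [|k hk].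
    by rewrite sM ?sN ?negb_and ?hi // eqxx mul1r.
  by rewrite sM ?negb_and ?hi // eq_sym (negPf hk) mul0r.
rewrite (bigD1 j) //= big1 ?addr0 => [|k hk].
  by rewrite sM ?sN ?negb_and ?hj ?orbT // eqxx mulr1.
by rewrite sN ?negb_and ?hj ?orbT // (negPf hk) mulr0.
Qed.

(** M - 1 and N - 1 annihilate each other: no block index lies in both
    supports. *)
Lemma supp_comm P Q M N : (forall x, (x < m)%N -> ~~ (P x && Q x)) ->
  supp P M -> supp Q N -> M *m N = N *m M.
Proof.
have main P1 P2 M1 M2 : (forall x, (x < m)%N -> ~~ (P1 x && P2 x)) ->
    supp P1 M1 -> supp P2 M2 -> (M1 - 1%:M) *m (M2 - 1%:M) = 0.
  move=> dis s1 s2; apply/matrixP=> i j; rewrite !mxE big1 // => k _.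
  have := dis (mxtens_unindex k).1 (ltn_ord _); rewrite negb_and => /orP[hk|hk].
    by rewrite !mxE s1 ?negb_and ?hk ?orbT // subrr mul0r.
  by rewrite !mxE s2 ?negb_and ?hk ?orbT // subrr mulr0.
have sumE X Y : (X - 1%:M) *m (Y - 1%:M) = 0 :> 'M[S]_(m * n) ->
    X *m Y = X + Y - 1%:M.
  rewrite mulmxBl !mulmxBr !mulmx1 !mul1mx => /eqP.
  by rewrite subr_eq0 subr_eq => /eqP->; rewrite addrC addrA.
move=> dis sM sN; rewrite (sumE _ _ (main _ _ _ _ dis sM sN)).
rewrite (sumE N M) ?[N + M]addrC //.
by apply: main sN sM => x hx; rewrite andbC dis.
Qed.

Lemma supp_rows (P : pred nat) E :
  (forall x y, (x < m)%N -> (y < m)%N ->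
     ~~ (P x && P y) -> E x y = (x == y)%:R%:M) -> supp P (blk E).
Proof.
move=> h i j hP; rewrite mxE h ?ltn_ord // !mxE.
case: (mxtens_indexP i) => a b; case: (mxtens_indexP j) => c d.
rewrite !mxtens_indexK /= (can_eq (@mxtens_indexK _ _)) xpair_eqE -val_eqE.
by rewrite /= -mulrnA mulnb.
Qed.

(** Stacking the combinations gives a left inverse.  This proves invertibility
    by solving for one block row at a time, with no determinant. *)
Lemma unitmx_span M :
  (forall x, (x < m)%N -> exists Y, Y *m M = Erow x) -> M \in unitmx.
Proof.
move=> h.
have hY (x : 'I_m) : {Y | Y *m M == Erow x}.
  by apply: sigW; case: (h x (ltn_ord x)) => Y <-; exists Y.
pose N : 'M[S]_(m * n) := \sum_(x < m) Ecol x *m sval (hY x).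
suff /mulmx1_unit[] : N *m M = 1%:M by [].
apply: eq_rows => x hx; rewrite mulmx1 /N mulmx_suml mulmx_sumr.
rewrite (bigD1 (Ordinal hx)) //= big1 ?addr0 => [|y hy].
  rewrite -mulmxA (eqP (svalP (hY _))) /= mulmxA Erow_Ecol // eqxx.
  by rewrite mul_scalar_mx scale1r.
rewrite -mulmxA mulmxA Erow_Ecol //.
have /negPf-> : x != y :> nat by rewrite eq_sym.
by rewrite mul_scalar_mx scale0r.
Qed.

End Blocks.

(** * Elementary matrices and their products *)

Ltac ifs := repeat (case: ifP => ?); try by []; try (exfalso; lia).

Section Elementary.
Variables (F : fieldType) (m n : nat).
Local Notation E := (@Erow F m n).

Ltac delta0 := ifs; by case: eqP => [?|_]; [exfalso; lia | rewrite raddf0].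

Lemma row_elem_pos j (P : 'M[F]_n) x : (0 < j < m)%N ->
  E x *m elem_mx m j%:Z P =
  if x == (m - j - 1)%N then P *m E x + E x.+1
  else if x == (m - j)%N then E x.-1 else E x.
Proof.
move=> hj; case: (ltnP x m) => [hx|hx]; last first.
  by rewrite (Erow_out F n hx) mul0mx !ifF //; lia.
case: ifP => xp; [|case: ifP => xp1].
- rewrite (row_blk2 (z := x) (z' := x.+1) hx) /=; [|lia|by move=> y _ yx yx1; delta0].
  by congr (_ + _); ifs; rewrite mul1mx.
- rewrite (row_blk1 (z := x.-1) hx) /=; last by move=> y _ yx; delta0.
  by ifs; rewrite mul1mx.
- rewrite (row_blk1 (z := x) hx) /=; last by move=> y _ yx; delta0.
  by ifs; rewrite eqxx mul1mx.
Qed.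

Lemma row_elem_neg j (P : 'M[F]_n) x : (0 < j < m)%N ->
  E x *m elem_mx m (- j%:Z) P =
  if x == (m - j - 1)%N then E x.+1
  else if x == (m - j)%N then E x.-1 + P *m E x else E x.
Proof.
move=> hj; case: (ltnP x m) => [hx|hx]; last first.
  by rewrite (Erow_out F n hx) mul0mx !ifF //; lia.
case: ifP => xp; [|case: ifP => xp1].
- rewrite (row_blk1 (z := x.+1) hx) /=; last by move=> y _ yx; delta0.
  by ifs; rewrite mul1mx.
- rewrite (row_blk2 (z := x.-1) (z' := x) hx) /=; [|lia|by move=> y _ yx yx1; delta0].
  by congr (_ + _); ifs; rewrite mul1mx.
- rewrite (row_blk1 (z := x) hx) /=; last by move=> y _ yx; delta0.
  by ifs; rewrite eqxx mul1mx.
Qed.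

Lemma row_elem_0 (P : 'M[F]_n) x : (0 < m)%N ->
  E x *m elem_mx m 0 P = if x == m.-1 then P *m E x else E x.
Proof.
move=> hm; case: (ltnP x m) => [hx|hx]; last first.
  by rewrite (Erow_out F n hx) mul0mx !ifF //; lia.
rewrite (row_blk1 (z := x) hx) /=; last by move=> y _ yx; delta0.
by ifs; rewrite eqxx mul1mx.
Qed.

Lemma row_elem_last (P : 'M[F]_n) x : (0 < m)%N ->
  E x *m elem_mx m (- m%:Z) P = if x == 0%N then P *m E x else E x.
Proof.
move=> hm; case: (ltnP x m) => [hx|hx]; last first.
  by rewrite (Erow_out F n hx) mul0mx !ifF //; lia.
rewrite (row_blk1 (z := x) hx) /=; last by move=> y _ yx; delta0.
by ifs; rewrite eqxx mul1mx.
Qed.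

(** The distinguished pair m - |i| - 1, m - |i| of block indices.  When i is 0 or
    -m one of the two falls out of range, which leaves the single block that the
    matrix changes; hence no case distinction is needed. *)
Definition touch (i : int) (x : nat) : bool :=
  (m <= x + absz i + 1)%N && (x + absz i <= m)%N.

Lemma supp_elem i (P : 'M[F]_n) : - m%:Z <= i < m%:Z ->
  supp (touch i) (elem_mx m i P).
Proof.
move=> hi; apply: supp_rows => x y hx hy; rewrite /touch /= => hxy.
by ifs.
Qed.

Variable A : 'M[{poly F}]_n.
Local Notation M := (elem_coef_mx m A).
Local Notation Mt := (tuple_mx m A).

Lemma tuple_mx_nil : Mt [::] = 1%:M.
Proof. by rewrite /tuple_mx big_nil. Qed.

Lemma tuple_mx_cons i t : Mt (i :: t) = M i *m Mt t.
Proof. by rewrite /tuple_mx big_cons. Qed.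

Lemma tuple_mx1 i : Mt [:: i] = M i.
Proof. by rewrite tuple_mx_cons tuple_mx_nil mulmx1. Qed.

Lemma tuple_mx_cat s t : Mt (s ++ t) = Mt s *m Mt t.
Proof.
elim: s => [|i s IH] /=; first by rewrite tuple_mx_nil mul1mx.
by rewrite !tuple_mx_cons IH mulmxA.
Qed.

Lemma tuple_supp P t : {in t, forall i, supp P (M i)} -> supp P (Mt t).
Proof.
elim: t => [|i t IH] h; first by rewrite tuple_mx_nil; apply: supp1.
rewrite tuple_mx_cons; apply: supp_mul; first by apply: h; rewrite inE eqxx.
by apply: IH => j hj; apply: h; rewrite inE hj orbT.
Qed.

(** Such indices have disjoint supports. *)
Lemma elem_comm i j : - m%:Z <= i < m%:Z -> - m%:Z <= j < m%:Z ->
  (0 <= i) = (0 <= j) -> 1 < `|i - j| -> M i *m M j = M j *m M i.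
Proof.
move=> hi hj hij d.
apply: supp_comm (supp_elem _ hi) (supp_elem _ hj) => x _.
rewrite /touch; lia.
Qed.

Lemma tuple_mx_swap s t b :
  {in s, forall i, (- m%:Z <= i < m%:Z) && ((0 <= i) == b)} ->
  swap_equiv s t -> Mt s = Mt t.
Proof.
move=> + st; elim: st => [//|s1 s2 u i j d _ IH] hs.
rewrite -IH; last first.
  move=> l; rewrite mem_cat !inE => hl; apply: hs.
  by case/or4P: hl => h; rewrite mem_cat !inE h ?orbT.
have /andP[hi /eqP bi] : (- m%:Z <= i < m%:Z) && ((0 <= i) == b).
  by apply: hs; rewrite mem_cat !inE eqxx orbT.
have /andP[hj /eqP bj] : (- m%:Z <= j < m%:Z) && ((0 <= j) == b).
  by apply: hs; rewrite mem_cat !inE eqxx !orbT.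
rewrite !tuple_mx_cat !tuple_mx_cons; congr (_ *m _).
by rewrite !mulmxA elem_comm // bi bj.
Qed.

End Elementary.

(** * The factors of the pencil *)

Definition odds (q k : nat) : seq int :=
  [seq Posz (q + 2 * i + 1) | i <- rev (iota 0 k)].
Definition evens (q k : nat) : seq int :=
  [seq Posz (q + 2 * i + 2) | i <- rev (iota 0 k)].
Definition pairs (q k : nat) : seq int :=
  flatten [seq range (q + 2 * i + 1) (q + 2 * i + 2) | i <- rev (iota 0 k)].

Lemma rev_iotaS k : rev (iota 0 k.+1) = k :: rev (iota 0 k).
Proof. by rewrite -addn1 iotaD rev_cat. Qed.

Lemma oddsS q k : odds q k.+1 = Posz (q + 2 * k + 1) :: odds q k.
Proof. by rewrite /odds rev_iotaS. Qed.

Lemma evensS q k : evens q k.+1 = Posz (q + 2 * k + 2) :: evens q k.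
Proof. by rewrite /evens rev_iotaS. Qed.

Lemma pairsS q k : pairs q k.+1 =
  [:: Posz (q + 2 * k + 1), Posz (q + 2 * k + 2) & pairs q k].
Proof.
rewrite /pairs rev_iotaS /= /range.
by rewrite (_ : (_.+1 - _)%N = 2%N) /= ?addnS //; lia.
Qed.

Lemma rangeS q : range 0 q.+1 = range 0 q ++ [:: Posz q.+1].
Proof. by rewrite /range !subn0 -(addn1 q.+1) iotaD map_cat. Qed.

Lemma rev_cS q : rev_c q.+1 = range 0 q ++ rev_c q.
Proof. by rewrite /rev_c rev_iotaS. Qed.

Lemma shift_cat s t j : shift (s ++ t) j = shift s j ++ shift t j.
Proof. exact: map_cat. Qed.

Lemma shift_cons i t j : shift (i :: t) j = i + j :: shift t j.
Proof. by []. Qed.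

Lemma shift0 t : shift t 0 = t.
Proof. by rewrite /shift -[RHS]map_id; apply: eq_map => x; rewrite addr0. Qed.

Lemma shiftK j t : shift (shift t j) (- j) = t.
Proof. by rewrite /shift mapK // => x; rewrite addrK. Qed.

Lemma swap_equiv_shift s t j : swap_equiv s t ->
  swap_equiv (shift s j) (shift t j).
Proof.
elim=> [u|s1 s2 u i l d _ IH]; first exact: swap_refl.
rewrite !shift_cat !shift_cons in IH *.
by apply: swap_step IH; rewrite (_ : _ - _ = i - l) //; ring.
Qed.

Lemma mem_odds q k i : i \in odds q k ->
  exists2 j, i = Posz (q + 2 * j + 1) & (j < k)%N.
Proof. by case/mapP => j; rewrite mem_rev mem_iota => hj ->; exists j. Qed.

Lemma mem_range a b i : i \in range a b ->
  exists2 j, i = Posz j & (a <= j <= b)%N.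
Proof. by case/mapP => j; rewrite mem_iota => hj ->; exists j => //; lia. Qed.

Section Factors.
Variables (F : fieldType) (m n : nat) (A : 'M[{poly F}]_n).
Local Notation E := (@Erow F m n).
Local Notation M := (elem_coef_mx m A).
Local Notation Mt := (tuple_mx m A).
Local Notation a := (mxcoef A).

Lemma elem_tuple_comm i t : {in t, forall j, M i *m M j = M j *m M i} ->
  M i *m Mt t = Mt t *m M i.
Proof.
elim: t => [|j t IH] h; first by rewrite tuple_mx_nil mulmx1 mul1mx.
rewrite tuple_mx_cons mulmxA h ?inE ?eqxx // -!mulmxA IH // => l hl.
by apply: h; rewrite inE hl orbT.
Qed.

(** Each even-placed factor can be moved to the right of all later odd-placed
    ones, as their indices are smaller by three or more. *)
Lemma pairs_split q k j b :
  (forall i, (q < i <= q + 2 * k)%N ->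
     (- m%:Z <= i%:Z + j < m%:Z) && ((0 <= i%:Z + j) == b)) ->
  Mt (shift (pairs q k) j) =
  Mt (shift (odds q k) j) *m Mt (shift (evens q k) j).
Proof.
elim: k => [|k IH] h; first by rewrite tuple_mx_nil mulmx1.
rewrite pairsS oddsS evensS !shift_cons !tuple_mx_cons.
rewrite IH => [|i hi]; last by apply: h; lia.
rewrite -!mulmxA; congr (_ *m _); rewrite !mulmxA; congr (_ *m _).
apply: elem_tuple_comm => l /mapP[_ /mem_odds[o -> ho] ->].
have /andP[h1 /eqP b1] := h (q + 2 * k + 2)%N ltac:(lia).
have /andP[h2 /eqP b2] := h (q + 2 * o + 1)%N ltac:(lia).
by apply: elem_comm => //; [rewrite b1 b2 | lia].
Qed.

Lemma elem_posE j : M j%:Z = elem_mx m j%:Z (- a j).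
Proof. by []. Qed.

Lemma elem_negE j : (j < m)%N -> M (j%:Z - m%:Z) = elem_mx m (- (m - j)%N%:Z) (a (m - j)).
Proof.
move=> hj; rewrite /elem_coef_mx ifF; last by lia.
by rewrite (_ : absz _ = (m - j)%N); [congr elem_mx |]; lia.
Qed.

Lemma row_odds_pos k x : (2 * k < m)%N ->
  E x *m Mt (odds 0 k) =
  if (m - 2 * k <= x < m)%N then
    if odd (m - 1 - x) then - a (m - 1 - x) *m E x + E x.+1 else E x.-1
  else E x.
Proof.
elim: k x => [|k IH] x hk; first by rewrite tuple_mx_nil mulmx1; ifs.
rewrite oddsS tuple_mx_cons mulmxA elem_posE row_elem_pos; last by lia.
case: ifP => [/eqP xp|xp].
  rewrite mulmxDl -mulmxA !IH; try lia; ifs.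
  by rewrite (_ : (m - 1 - x)%N = (0 + 2 * k + 1)%N) //; lia.
by case: ifP => xp1; rewrite IH; try lia; ifs.
Qed.

Lemma row_evens_pos k x : (2 * k < m)%N ->
  E x *m Mt (evens 0 k ++ [:: 0]) =
  if (m - 1 - 2 * k <= x < m)%N then
    if odd (m - 1 - x) then E x.-1 else - a (m - 1 - x) *m E x + E x.+1
  else E x.
Proof.
elim: k x => [|k IH] x hk.
  rewrite tuple_mx1 elem_posE row_elem_0 //; ifs.
  rewrite (@Erow_out _ _ _ x.+1) ?addr0; last by lia.
  by rewrite (_ : (m - 1 - x)%N = 0%N) //; lia.
rewrite evensS cat_cons tuple_mx_cons mulmxA elem_posE row_elem_pos; last by lia.
case: ifP => [/eqP xp|xp].
  rewrite mulmxDl -mulmxA !IH; try lia; ifs.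
  by rewrite (_ : (m - 1 - x)%N = (0 + 2 * k + 2)%N) //; lia.
by case: ifP => xp1; rewrite IH; try lia; ifs.
Qed.

Lemma row_odds_neg q k x : (q + 2 * k < m)%N ->
  E x *m Mt (shift (odds q k) (- m%:Z)) =
  if (q <= x < q + 2 * k)%N then
    if odd (x + q) then E x.-1 + a (m - x) *m E x else E x.+1
  else E x.
Proof.
elim: k x => [|k IH] x hk; first by rewrite tuple_mx_nil mulmx1; ifs.
rewrite oddsS shift_cons tuple_mx_cons mulmxA elem_negE; last by lia.
rewrite row_elem_neg; last by lia.
case: ifP => [/eqP xp|xp]; first by rewrite !IH; try lia; ifs.
case: ifP => [/eqP xp1|xp1]; last by rewrite IH; try lia; ifs.
rewrite mulmxDl -mulmxA !IH; try lia; ifs.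
by rewrite (_ : (m - x)%N = (m - (q + 2 * k + 1))%N) //; lia.
Qed.

Lemma row_evens_neg q k x : (q + 2 * k < m)%N ->
  E x *m Mt (shift (evens q k) (- m%:Z)) =
  if (q < x <= q + 2 * k)%N then
    if odd (x + q) then E x.+1 else E x.-1 + a (m - x) *m E x
  else E x.
Proof.
elim: k x => [|k IH] x hk; first by rewrite tuple_mx_nil mulmx1; ifs.
rewrite evensS shift_cons tuple_mx_cons mulmxA elem_negE; last by lia.
rewrite row_elem_neg; last by lia.
case: ifP => [/eqP xp|xp]; first by rewrite !IH; try lia; ifs.
case: ifP => [/eqP xp1|xp1]; last by rewrite IH; try lia; ifs.
rewrite mulmxDl -mulmxA !IH; try lia; ifs.
by rewrite (_ : (m - x)%N = (m - (q + 2 * k + 2))%N) //; lia.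
Qed.

Lemma row_range_neg q x : (q < m)%N ->
  E x *m Mt (shift (range 0 q) (- m%:Z)) =
  if (x <= q)%N then a (m - x) *m E q + (if (0 < x)%N then E x.-1 else 0)
  else E x.
Proof.
elim: q x => [|q IH] x hq.
  rewrite shift_cons tuple_mx1 add0r /elem_coef_mx ifF; last by lia.
  rewrite abszN /= row_elem_last //; case: x => [|x] //=.
  by rewrite subn0 addr0.
rewrite rangeS shift_cat tuple_mx_cat mulmxA IH; last by lia.
rewrite tuple_mx1 elem_negE //.
have R y := row_elem_neg (a (m - q.+1)) y (_ : 0 < (m - q.+1) < m)%N.
case: ifP => hx; last by rewrite R; try lia; ifs; rewrite addrC (_ : x = q.+1) //; lia.
rewrite mulmxDl -mulmxA R; last by lia.
by ifs; rewrite ?mul0mx // R; try lia; ifs.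
Qed.

(** The leading p x p blocks are Hankel, with the leading coefficient on the
    antidiagonal and zeros above it; the other blocks are those of the
    identity. *)
Definition hankel (p x y : nat) : 'M[F]_n :=
  if (x < p)%N && (y < p)%N then
    if (p <= x + y + 1)%N then a (m + p - 1 - x - y) else 0
  else if x == y then 1%:M else 0.

Lemma row_hankel_out p y : (p <= y)%N ->
  E y *m blk m (hankel p) = E y.
Proof.
move=> hy; case: (ltnP y m) => [lty|ley]; last by rewrite Erow_out ?mul0mx.
rewrite (row_blk1 (z := y)) // /hankel; last by move=> z hz zy; ifs.
by ifs; rewrite ?mul1mx //; lia.
Qed.

(** Multiplying by the product over (0:p) on the left shifts the Hankel block
    down by one and puts a_m, ..., a_(m-p) in the new last block column. *)
Lemma rev_c_hankel p : (p <= m)%N ->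
  Mt (shift (rev_c p) (- m%:Z)) = blk m (hankel p).
Proof.
elim: p => [|p IH] hp.
  rewrite tuple_mx_nil; apply: eq_rows => x hx; rewrite mulmx1.
  rewrite (row_blk1 (z := x)) // /hankel /= ?eqxx ?mul1mx // => y hy yx.
  by rewrite eq_sym (negPf yx).
rewrite rev_cS shift_cat tuple_mx_cat IH; last by lia.
apply: eq_rows => x hx; rewrite mulmxA row_range_neg //.
case: ifP => xp; last by rewrite !row_hankel_out //; lia.
rewrite mulmxDl -mulmxA row_hankel_out // row_blk //.
have -> : (if (0 < x)%N then E x.-1 else 0) *m blk m (hankel p)
    = \sum_(y < m) (if (0 < x)%N then hankel p x.-1 y else 0) *m E y.
  case: ifP => h0; first by rewrite row_blk //; lia.
  by rewrite mul0mx big1 // => y _; rewrite mul0mx.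
pose f y := if y == p then a (m - x) else 0.
have <- : \sum_(y < m) f y *m E y = a (m - x) *m E p.
  by rewrite (@sum_Erow1 _ _ _ f p) /f ?eqxx // => y _ /negPf->.
rewrite -big_split /=; apply: eq_bigr => y _; rewrite -mulmxDl; congr (_ *m _).
rewrite /f /hankel.
by ifs; rewrite ?add0r ?addr0 //; congr a; lia.
Qed.

End Factors.

(** * The core pencil *)

Section Core.
Variables (F : fieldType) (m n : nat) (A : 'M[{poly F}]_n).
Variables (q c : nat).
Local Notation E := (@Erow F m n).
Local Notation a := (mxcoef A).
Local Notation Mt := (tuple_mx m A).

(** The blocks of the product of all odd-placed factors: pairs of blocks from q
    on, with the single block c left alone.  From q on, a block index x has even
    or odd type according to the parity of x + q. *)
Definition Gfun (x y : nat) : 'M[F]_n :=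
  if (q <= x < c)%N then
    if odd (x + q) then
      if y == x.-1 then 1%:M else if y == x then a (m - x) else 0
    else if y == x.+1 then 1%:M else 0
  else if (c < x)%N then
    if odd (x + q) then
      if y == x then - a (m - 1 - x) else if y == x.+1 then 1%:M else 0
    else if y == x.-1 then 1%:M else 0
  else if x == y then 1%:M else 0.

(** The blocks of the two coefficients of the core pencil X T1 - T0. *)
Definition T1fun (x y : nat) : 'M[F]_n :=
  if (x <= q)%N || (y <= q)%N then hankel m A q.+1 x y
  else if odd (x + q) then if y == x.+1 then 1%:M else 0
  else if y == x.-1 then 1%:M else if y == x then a (m - x) else 0.

Definition T0fun (x y : nat) : 'M[F]_n :=
  if (x < q)%N || (y < q)%N then hankel m A q x y
  else if odd (x + q) then if y == x.-1 then 1%:M else 0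
  else if y == x then - a (m - 1 - x) else if y == x.+1 then 1%:M else 0.

Local Notation G := (blk m Gfun).
Local Notation T1 := (blk m T1fun).
Local Notation T0 := (blk m T0fun).

Lemma row_G x : (x < m)%N ->
  E x *m G =
  if (q <= x < c)%N then
    if odd (x + q) then E x.-1 + a (m - x) *m E x else E x.+1
  else if (c < x)%N then
    if odd (x + q) then - a (m - 1 - x) *m E x + E x.+1 else E x.-1
  else E x.
Proof.
move=> hx; case: ifP => h1; [|case: ifP => h2]; try case: ifP => h3.
- rewrite (row_blk2 (z := x.-1) (z' := x)) // /Gfun; [|lia|].
    by rewrite h1 h3 !eqxx; ifs; rewrite mul1mx.
  by move=> y _ /negPf yx /negPf yx'; rewrite h1 h3 yx yx'.
- rewrite (row_blk1 (z := x.+1)) // /Gfun h1 h3 ?eqxx ?mul1mx //.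
  by move=> y _ /negPf->.
- rewrite (row_blk2 (z := x) (z' := x.+1)) // /Gfun; [|lia|].
    by rewrite h1 h2 h3 !eqxx; ifs; rewrite mul1mx.
  by move=> y _ /negPf yx /negPf yx'; rewrite h1 h2 h3 yx yx'.
- rewrite (row_blk1 (z := x.-1)) // /Gfun h1 h2 h3 ?eqxx ?mul1mx //.
  by move=> y _ /negPf->.
- rewrite (row_blk1 (z := x)) // /Gfun h1 h2 ?eqxx ?mul1mx //.
  by move=> y _; rewrite eq_sym => /negPf->.
Qed.

Lemma row_T1 x : (x < m)%N ->
  E x *m T1 =
  if (x <= q)%N then E x *m blk m (hankel m A q.+1)
  else if odd (x + q) then E x.+1 else E x.-1 + a (m - x) *m E x.
Proof.
move=> hx; case: ifP => h1; last case: ifP => h2.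
- by rewrite !row_blk //; apply: eq_bigr => y _; rewrite /T1fun h1.
- rewrite (row_blk1 (z := x.+1)) // /T1fun.
    by ifs; rewrite ?mul1mx //; lia.
  by move=> y _ /negPf yx; rewrite h1 h2 yx /= /hankel; ifs.
- rewrite (row_blk2 (z := x.-1) (z' := x)) // /T1fun; [|lia|].
    by rewrite h1 h2 /= !eqxx /hankel; ifs; rewrite mul1mx.
  by move=> y _ /negPf yx /negPf yx'; rewrite h1 h2 yx yx' /hankel; ifs.
Qed.

Lemma row_T0 x : (x < m)%N ->
  E x *m T0 =
  if (x < q)%N then E x *m blk m (hankel m A q)
  else if odd (x + q) then E x.-1 else - a (m - 1 - x) *m E x + E x.+1.
Proof.
move=> hx; case: ifP => h1; last case: ifP => h2.
- by rewrite !row_blk //; apply: eq_bigr => y _; rewrite /T0fun h1.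
- rewrite (row_blk1 (z := x.-1)) // /T0fun.
    by ifs; rewrite ?mul1mx //; lia.
  by move=> y _ /negPf yx; rewrite h1 h2 yx /= /hankel; ifs.
- rewrite (row_blk2 (z := x) (z' := x.+1)) // /T0fun; [|lia|].
    by rewrite h1 h2 /= !eqxx /hankel; ifs; rewrite mul1mx.
  by move=> y _ /negPf yx /negPf yx'; rewrite h1 h2 yx yx' /hankel; ifs.
Qed.

Variables (ku kl : nat).
Hypotheses (hc : c = (q + 2 * ku)%N) (hm : m = (c + 2 * kl).+1).

Local Notation Fm := (Mt (shift (odds q ku) (- m%:Z))).
Local Notation Sm := (Mt (shift (evens q ku) (- m%:Z))).
Local Notation Om := (Mt (odds 0 kl)).
Local Notation Em := (Mt (evens 0 kl ++ [:: 0])).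
Local Notation Rm := (Mt (shift (range 0 q) (- m%:Z))).
Local Notation Hm := (Mt (shift (rev_c q) (- m%:Z))).

Lemma G_factors : Fm *m Om = G.
Proof.
apply: eq_rows => x hx; rewrite mulmxA row_odds_neg ?row_G //; last by lia.
have O y := @row_odds_pos F m n A kl y ltac:(lia).
case: ifP => h1; last by rewrite O; ifs.
case: ifP => h2; last by rewrite O; ifs.
by rewrite mulmxDl -mulmxA !O; ifs.
Qed.

(** The identity T1 = M_O^-1 M_S M_R M_H, kept free of inverses. *)
Lemma T1_factor : Om *m T1 = Sm *m (Rm *m Hm).
Proof.
have eH : Rm *m Hm = blk m (hankel m A q.+1).
  by rewrite -rev_c_hankel ?rev_cS ?shift_cat ?tuple_mx_cat //; lia.
rewrite eH; apply: eq_rows => x hx.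
rewrite !mulmxA row_odds_pos ?row_evens_neg; try lia.
have H y := @row_hankel_out F m n A q.+1 y.
case: (leqP x c) => h1.
  rewrite ifF ?row_T1 //; last by lia.
  case: ifP => h2; first by ifs.
  case: ifP => h3; first by ifs; rewrite H //; lia.
  by ifs; rewrite mulmxDl -mulmxA !H //; lia.
rewrite ifT; last by lia.
rewrite [RHS](_ : _ = E x); last by ifs; rewrite H //; lia.
case: ifP => h2.
  rewrite mulmxDl -mulmxA !row_T1; try lia; ifs.
  by rewrite (_ : (m - x.+1)%N = (m - 1 - x)%N) ?mulNmx 1?addrC ?addrK //; lia.
by rewrite row_T1; try lia; ifs; congr E; lia.
Qed.

(** The identity T0 = M_F^-1 M_E M_H, kept free of inverses. *)
Lemma T0_factor : Fm *m T0 = Em *m Hm.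
Proof.
rewrite rev_c_hankel; last by lia.
apply: eq_rows => x hx.
rewrite !mulmxA row_odds_neg ?row_evens_pos; try lia.
rewrite -hc; have H y := @row_hankel_out F m n A q y.
case: (boolP (q <= x < c)%N) => h1; last first.
  rewrite ?(negPf h1) row_T0 //; case: ifP => h2; first by ifs.
  case: ifP => h3; first by ifs; rewrite H //; lia.
  by ifs; rewrite mulmxDl -mulmxA !H //; lia.
rewrite [RHS](_ : _ = E x); last by ifs; rewrite H //; lia.
rewrite ?h1; case: ifP => h2; last by rewrite row_T0; try lia; ifs.
rewrite mulmxDl -mulmxA !row_T0; try lia; ifs.
rewrite (_ : (m - 1 - x.-1)%N = (m - x)%N); last by lia.
rewrite (_ : x.-1.+1 = x); last by lia.
by rewrite mulNmx addrAC addNr add0r.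
Qed.

Lemma odds_pos_supp : supp (fun x => (c < x)%N) Om.
Proof.
apply: tuple_supp => i /mem_odds[j -> hj].
apply: supp_sub (supp_elem _ _) => [x hx|]; rewrite /touch; lia.
Qed.

Lemma odds_neg_supp : supp (fun x => (q <= x < c)%N) Fm.
Proof.
apply: tuple_supp => i /mapP[_ /mem_odds[j -> hj] ->].
apply: supp_sub (supp_elem _ _) => [x hx|]; rewrite /touch; lia.
Qed.

Lemma rev_c_neg_supp : supp (fun x => (x < q)%N) Hm.
Proof.
rewrite rev_c_hankel; last by lia.
apply: supp_rows => x y hx hy /negPf hxy; rewrite /hankel hxy.
by case: eqP; rewrite ?mul0rn ?scale0r ?raddf0.
Qed.

Lemma odds_comm : Fm *m Om = Om *m Fm.
Proof. by apply: supp_comm odds_neg_supp odds_pos_supp => x; lia. Qed.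

Lemma rev_c_G : Hm *m G = G *m Hm.
Proof.
rewrite -G_factors -mulmxA -(supp_comm _ rev_c_neg_supp odds_pos_supp).
  rewrite !mulmxA (supp_comm _ rev_c_neg_supp odds_neg_supp) //.
  by move=> x; lia.
by move=> x; lia.
Qed.

Lemma L1_factor : Fm *m Sm *m Rm *m Om *m (Fm *m Hm) = G *m T1 *m G.
Proof.
rewrite -[LHS]mulmxA [Om *m (_ *m _)]mulmxA -odds_comm G_factors -rev_c_G.
rewrite (_ : G *m T1 = Fm *m (Om *m T1)); last by rewrite mulmxA G_factors.
by rewrite T1_factor !mulmxA.
Qed.

Lemma L0_factor : Om *m Em *m Om *m (Fm *m Hm) = G *m T0 *m G.
Proof.
rewrite -[LHS]mulmxA [Om *m (_ *m _)]mulmxA -odds_comm G_factors -rev_c_G.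
rewrite (_ : G *m T0 = Om *m (Fm *m T0)).
  by rewrite T0_factor !mulmxA.
by rewrite mulmxA -odds_comm G_factors.
Qed.

End Core.

(** * Signs *)

Section Signs.
Variables (F : fieldType) (m n : nat) (A : 'M[{poly F}]_n) (q c d : nat).
Local Notation E := (@Erow F m n).
Local Notation a := (mxcoef A).
Local Notation G := (blk m (Gfun m A q c)).
Local Notation T1 := (blk m (T1fun m A q)).
Local Notation T0 := (blk m (T0fun m A q)).

(** The signs of the core pencil alternate along the Hankel part.  Beyond it the
    blocks are joined alternately by -I, which keeps the sign, and by X I, which
    changes it.  The offset [d] sets the overall sign. *)
Definition core_exp (x : nat) : nat :=
  (d + (if x <= q then x else q + (x - q)./2))%N.

Definition core_sign (x : nat) : F := (-1) ^+ core_exp x.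

(** The signs change beyond c, because there the coefficients in the factors of G
    have odd index and are skew-symmetric, while before c they have even index. *)
Definition pencil_sign (x : nat) : F := (-1) ^+ (core_exp x + (c < x)%N)%N.

Hypothesis mq : odd (m + q).
Hypothesis cq : ~~ odd (c + q).
Hypothesis qc : (q <= c < m)%N.
Hypothesis hev : forall j, (a j)^T = (-1) ^+ j *: a j.

Lemma sign_eq u v (X : 'M[F]_n) : odd u = odd v ->
  (-1) ^+ u *: X = (-1) ^+ v *: X.
Proof. by move=> h; rewrite -signr_odd h signr_odd. Qed.

Lemma sign_opp u v (X : 'M[F]_n) : odd u != odd v ->
  (-1) ^+ u *: X = - ((-1) ^+ v *: X).
Proof.
move=> uv; rewrite -scaleN1r scalerA -exprS; apply: sign_eq.
by rewrite /=; case: (odd u) uv; case: (odd v).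
Qed.

Ltac signs := rewrite ?trmx1 ?linearN ?trmx0 /= ?hev ?scaler0 ?scalerN ?scalerA
  -?exprD ?oppr0 //; try congr (- _); apply: sign_eq; lia.

Lemma G_sign : G^T *m sgmx m n core_sign = sgmx m n pencil_sign *m G.
Proof.
rewrite tr_blk blk_sgmx sgmx_blk; apply: eq_blk => x y hx hy.
rewrite /core_sign /pencil_sign /core_exp /Gfun.
case: (eqVneq y x) => [->|h1]; first by ifs; signs.
case: (eqVneq y x.+1) => [->|h2]; first by ifs; signs.
case: (eqVneq x y.+1) => [->|h3]; first by ifs; signs.
have /negPf h4 : y != x.-1 by lia.
have /negPf h5 : x != y.-1 by lia.
by rewrite h4 h5 !if_same trmx0 !scaler0.
Qed.

Lemma T1_sign : (sgmx m n core_sign *m T1)^T = - (sgmx m n core_sign *m T1).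
Proof.
rewrite sgmx_blk tr_blk opp_blk; apply: eq_blk => x y hx hy.
rewrite /core_sign /core_exp /T1fun.
rewrite [(y <= q)%N || _]orbC; case: (boolP ((x <= q) || (y <= q))%N) => h.
  rewrite /hankel [(y < _)%N && _]andbC (addnC y) linearZ /=.
  case: (boolP ((x < q.+1) && (y < q.+1))%N) => hxy; last first.
    have /negPf e : y != x by lia.
    by rewrite [x == y]eq_sym e trmx0 !scaler0 oppr0.
  case: (boolP (q < x + y + 1)%N) => h'; last by rewrite trmx0 !scaler0 oppr0.
  rewrite hev (_ : (m + q.+1 - 1 - y - x)%N = (m + q.+1 - 1 - x - y)%N);
    last by lia.
  by ifs; rewrite scalerA -exprD; apply: sign_opp; lia.
rewrite linearZ /=.
case: (eqVneq y x) => [->|h1].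
  by ifs; rewrite ?hev ?trmx0 ?scaler0 ?oppr0 // scalerA -exprD; apply: sign_opp; lia.
case: (eqVneq y x.+1) => [->|h2].
  by ifs; rewrite ?trmx1 ?trmx0 ?scaler0 ?oppr0 //; apply: sign_opp; lia.
case: (eqVneq x y.+1) => [->|h3].
  by ifs; rewrite ?trmx1 ?trmx0 ?scaler0 ?oppr0 //; apply: sign_opp; lia.
have /negPf h4 : y != x.-1 by lia.
have /negPf h5 : x != y.-1 by lia.
by rewrite h4 h5 !if_same trmx0 !scaler0 oppr0.
Qed.

Lemma T0_sign : (sgmx m n core_sign *m T0)^T = sgmx m n core_sign *m T0.
Proof.
rewrite sgmx_blk tr_blk; apply: eq_blk => x y hx hy.
rewrite /core_sign /core_exp /T0fun linearZ /=.
rewrite [(y < q)%N || _]orbC; case: (boolP ((x < q) || (y < q))%N) => h.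
  rewrite /hankel [(y < _)%N && _]andbC (addnC y).
  case: (boolP ((x < q) && (y < q))%N) => hxy.
    case: (boolP (q <= x + y + 1)%N) => h'; last by rewrite trmx0 !scaler0.
    rewrite hev (_ : (m + q - 1 - y - x)%N = (m + q - 1 - x - y)%N); last by lia.
    by ifs; rewrite scalerA -exprD; apply: sign_eq; lia.
  case: (eqVneq y x) => [->|_]; last by rewrite trmx0 !scaler0.
  by rewrite trmx1.
case: (eqVneq y x) => [->|h1]; first by ifs; signs.
case: (eqVneq y x.+1) => [->|h2]; first by ifs; signs.
case: (eqVneq x y.+1) => [->|h3]; first by ifs; signs.
have /negPf h4 : y != x.-1 by lia.
have /negPf h5 : x != y.-1 by lia.
by rewrite h4 h5 !if_same trmx0 !scaler0.
Qed.

(** By [G_sign], Q G T1 G = G^T (S T1) G. *)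
Lemma L1_sign : (sgmx m n pencil_sign *m (G *m T1 *m G))^T =
  - (sgmx m n pencil_sign *m (G *m T1 *m G)).
Proof.
rewrite !mulmxA -G_sign -!mulmxA trmx_mul mulmxA trmx_mul T1_sign trmxK.
by rewrite !mulmxN !mulNmx !mulmxA.
Qed.

Lemma L0_sign : (sgmx m n pencil_sign *m (G *m T0 *m G))^T =
  sgmx m n pencil_sign *m (G *m T0 *m G).
Proof.
by rewrite !mulmxA -G_sign -!mulmxA trmx_mul mulmxA trmx_mul T0_sign trmxK !mulmxA.
Qed.

End Signs.

(** * Connectedness of the pencil *)

Section Connected.
Variables (F : fieldType) (m n : nat) (A : 'M[{poly F}]_n) (q c ku kl : nat).
Hypotheses (hc : c = (q + 2 * ku)%N) (hm : m = (c + 2 * kl).+1).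
Hypothesis n_gt0 : (0 < n)%N.
Local Notation E := (@Erow F m n).
Local Notation a := (mxcoef A).
Local Notation G := (blk m (Gfun m A q c)).
Local Notation T1 := (blk m (T1fun m A q)).
Local Notation T0 := (blk m (T0fun m A q)).
Local Notation L1 := (G *m T1 *m G).
Local Notation L0 := (G *m T0 *m G).

Lemma Erow_scale_inj y (s t : F) : (y < m)%N -> s *: E y = t *: E y -> s = t.
Proof.
move=> hy /(congr1 (mulmx^~ (Ecol F m n y))) /=.
rewrite -!scalemxAl Erow_Ecol // eqxx !scalemx1 => /matrixP.
by move/(_ (Ordinal n_gt0) (Ordinal n_gt0)); rewrite !mxE !eqxx !mulr1n.
Qed.

Lemma row_blk_col (f : nat -> nat -> 'M[F]_n) x z : (x < m)%N -> (z < m)%N ->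
  E x *m blk m f *m Ecol F m n z = f x z.
Proof.
move=> hx hz; rewrite row_blk // mulmx_suml (bigD1 (Ordinal hz)) //=.
rewrite big1 ?addr0 => [|y hy]; rewrite -mulmxA Erow_Ecol //.
  by rewrite eqxx mulmx1.
have /negPf-> : y != z :> nat by [].
by rewrite raddf0 mulmx0.
Qed.

Lemma sgmx_Ecol (p : nat -> F) z : sgmx m n p *m Ecol F m n z = p z *: Ecol F m n z.
Proof. by rewrite -[sgmx _ _ _]trmxK tr_sgmx -trmx_mul row_sgmx linearZ. Qed.

Lemma G_Ecol z : (z < q)%N -> G *m Ecol F m n z = Ecol F m n z.
Proof.
move=> hz; apply: eq_rows => x hx; rewrite mulmxA row_G //.
have E0 y : (q <= y)%N -> E y *m Ecol F m n z = 0.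
  move=> hy; case: (ltnP y m) => [?|?]; last by rewrite Erow_out ?mul0mx.
  by rewrite Erow_Ecol // gtn_eqF ?raddf0 //; lia.
by ifs; rewrite ?mulmxDl -?mulmxA !E0 ?mulmx0 ?addr0 //; lia.
Qed.

(** The block rows of even type other than c are a single identity block in both
    coefficients; these rows suffice to join all the blocks from q on. *)
Lemma row_L1_low x : (c < x < m)%N -> ~~ odd (x + q) -> E x *m L1 = E x.-1.
Proof.
move=> hx px; rewrite !mulmxA row_G; try lia; ifs.
rewrite row_T1; try lia; ifs; rewrite row_G; try lia; ifs.
Qed.

Lemma row_L0_low x : (c < x < m)%N -> ~~ odd (x + q) ->
  E x *m L0 = E (if x == c.+2 then c else x - 3)%N.
Proof.
move=> hx px; rewrite !mulmxA row_G; try lia; ifs.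
  rewrite row_T0; try lia; ifs; rewrite row_G; try lia; ifs.
  by congr E; lia.
rewrite row_T0; try lia; ifs; rewrite row_G; try lia; ifs.
by congr E; lia.
Qed.

Lemma row_L1_up x : (q <= x < c)%N -> ~~ odd (x + q) ->
  E x *m L1 = E (if x.+2 == c then c else x + 3)%N.
Proof.
move=> hx px; rewrite !mulmxA row_G; try lia; ifs.
  rewrite row_T1; try lia; ifs; rewrite row_G; try lia; ifs.
  by congr E; lia.
rewrite row_T1; try lia; ifs; rewrite row_G; try lia; ifs.
by congr E; lia.
Qed.

Lemma row_L0_up x : (q <= x < c)%N -> ~~ odd (x + q) -> E x *m L0 = E x.+1.
Proof.
move=> hx px; rewrite !mulmxA row_G; try lia; ifs.
by rewrite row_T0; try lia; ifs; rewrite row_G; try lia; ifs.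
Qed.

(** Here p stands for the quotient of two solutions Q; commuting with a matrix
    forces it to agree on block indices joined by a nonzero block. *)
Variable p : nat -> F.
Hypothesis pL1 : sgmx m n p *m L1 = L1 *m sgmx m n p.
Hypothesis pL0 : sgmx m n p *m L0 = L0 *m sgmx m n p.

Lemma link (M : 'M[F]_(m * n)) x y :
  sgmx m n p *m M = M *m sgmx m n p -> E x *m M = E y ->
  (y < m)%N -> p x = p y.
Proof.
move=> pM xM hy; apply: (@Erow_scale_inj y) => //.
by rewrite -xM scalemxAl -row_sgmx -mulmxA pM mulmxA xM row_sgmx.
Qed.

Lemma connected_low j : (c + 2 * j < m)%N ->
  p (c + 2 * j)%N = p c /\ ((0 < j)%N -> p (c + 2 * j - 1)%N = p c).
Proof.
elim: j => [|j IH] hj; first by rewrite addn0.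
have hx : (c < c + 2 * j.+1 < m)%N by lia.
have px : ~~ odd (c + 2 * j.+1 + q)%N by lia.
have /(_ ltac:(by ifs; lia)) e0 := link pL0 (row_L0_low hx px).
have /(_ ltac:(lia)) e1 := link pL1 (row_L1_low hx px).
suff e : p (c + 2 * j.+1)%N = p c.
  by split=> // _; rewrite -e e1 ?subn1 //; lia.
case: (posnP j) e0 => [->|j0] e0; first by rewrite e0 ?ifT //; lia.
have [_ <- //] := IH ltac:(lia).
move: e0; rewrite ifF; last by lia.
by move=> ->; congr p; lia.
Qed.

Lemma connected_up j : (q + 2 * j <= c)%N ->
  p (c - 2 * j)%N = p c /\ ((0 < j)%N -> p (c - 2 * j + 1)%N = p c).
Proof.
elim: j => [|j IH] hj; first by rewrite subn0.
have hx : (q <= c - 2 * j.+1 < c)%N by lia.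
have px : ~~ odd (c - 2 * j.+1 + q)%N by lia.
have /(_ ltac:(lia)) e0 := link pL0 (row_L0_up hx px).
have /(_ ltac:(by ifs; lia)) e1 := link pL1 (row_L1_up hx px).
suff e : p (c - 2 * j.+1)%N = p c.
  by split=> // _; rewrite -e e0 ?addn1 //; lia.
case: (posnP j) e1 => [->|j0] e1; first by rewrite e1 ?ifT //; lia.
have [_ <- //] := IH ltac:(lia).
move: e1; rewrite ifF; last by lia.
by move=> ->; congr p; lia.
Qed.

Lemma connected_tail x : (q <= x < m)%N -> p x = p c.
Proof.
move=> hx; case: (leqP x c) => hxc; case: (boolP (odd (x + q))) => px.
- have [_ <-] := @connected_up ((c - x + 1)./2) ltac:(lia); last by lia.
  by congr p; lia.
- have [<- _] := @connected_up ((c - x)./2) ltac:(lia).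
  by congr p; lia.
- have [_ <-] := @connected_low ((x - c + 1)./2) ltac:(lia); last by lia.
  by congr p; lia.
- have [<- _] := @connected_low ((x - c)./2) ltac:(lia).
  by congr p; lia.
Qed.

Hypothesis am : a m != 0.

Lemma am_scale_inj (s t : F) : s *: a m = t *: a m -> s = t.
Proof.
move/eqP; rewrite -subr_eq0 -scalerBl scaler_eq0 subr_eq0 (negPf am) orbF.
by move/eqP.
Qed.

Lemma link_entry (M : 'M[F]_(m * n)) x y :
  sgmx m n p *m M = M *m sgmx m n p ->
  E x *m M *m Ecol F m n y = a m -> p x = p y.
Proof.
move=> pM e; apply: am_scale_inj; rewrite -e.
rewrite scalemxAl scalemxAl -row_sgmx -[_ *m sgmx _ _ _ *m M]mulmxA pM !mulmxA.
by rewrite -[_ *m sgmx _ _ _ *m _]mulmxA sgmx_Ecol -scalemxAr.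
Qed.

(** In the Hankel part, a_m sits on the antidiagonal of the leading coefficient
    and on the preceding one of the other. *)
Lemma hankel_link0 x : (x < q)%N -> p x = p (q - 1 - x)%N.
Proof.
move=> hx; apply: (link_entry pL0).
rewrite !mulmxA row_G; try lia; ifs.
rewrite row_T0; try lia; ifs.
rewrite -mulmxA G_Ecol; last by lia.
rewrite row_blk_col; try lia.
by rewrite /hankel; ifs; congr a; lia.
Qed.

Lemma hankel_link1 x : (0 < x < q)%N -> p x = p (q - x)%N.
Proof.
move=> hx; apply: (link_entry pL1).
rewrite !mulmxA row_G; try lia; ifs.
rewrite row_T1; try lia; ifs.
rewrite -mulmxA G_Ecol; last by lia.
rewrite row_blk_col; try lia.
by rewrite /hankel; ifs; congr a; lia.
Qed.

(** The first block row of the leading coefficient is a_m in the column of the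
    block q, which G moves to q + 1 unless q = c. *)
Lemma hankel_link_tail : (0 < q)%N -> p 0 = p c.
Proof.
move=> hq; pose y := if (q < c)%N then q.+1 else q.
rewrite -(@connected_tail y); last by rewrite /y; ifs; lia.
apply: (link_entry pL1).
rewrite !mulmxA row_G; try lia; ifs.
rewrite row_T1 ?leq0n; last by lia.
rewrite (row_blk1 (z := q)); [|lia|]; last by move=> z hz zq; rewrite /hankel; ifs.
rewrite -[_ *m E q *m _]mulmxA (_ : E q *m _ = E y).
  rewrite -mulmxA Erow_Ecol ?eqxx ?mulmx1 /hankel; last by rewrite /y; ifs; lia.
  by ifs; congr a; lia.
by rewrite row_G; try lia; rewrite /y; ifs.
Qed.

(** The reflections x -> q-1-x and x -> q-x compose to the shift by one, which
    carries the Hankel part down to its first block. *)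
Lemma connected x : (x < m)%N -> p x = p c.
Proof.
move=> hx; case: (leqP q x) => hq; first by rewrite connected_tail ?hq.
elim: x hx hq => [|x IH] hx hq; first by rewrite hankel_link_tail.
rewrite hankel_link1 // (_ : (q - x.+1)%N = (q - 1 - x)%N); last by lia.
by rewrite -hankel_link0 ?IH //; lia.
Qed.

End Connected.

(** * The core pencil is a linearization *)

Section BlockColumn.
Variables (S : comUnitRingType) (m n : nat).

Definition bcol (v : nat -> 'M[S]_n) : 'M[S]_(m * n, n) :=
  \matrix_(i, j) v (mxtens_unindex i).1 (mxtens_unindex i).2 j.

Lemma row_bcol v x : (x < m)%N -> Erow S m n x *m bcol v = v x.
Proof.
by move=> hx; apply/matrixP=> i j; rewrite Erow_mulE mxE mxtens_indexK.
Qed.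

End BlockColumn.

Section CorePoly.
Variables (F : fieldType) (m n : nat).
Local Notation K := {poly F}.
Local Notation E := (@Erow K m n).

Lemma cmxM p q r (M : 'M[F]_(p, q)) (N : 'M[F]_(q, r)) :
  cmx (M *m N) = cmx M *m cmx N.
Proof. exact: map_mxM. Qed.

Lemma cmxD p q (M N : 'M[F]_(p, q)) : cmx (M + N) = cmx M + cmx N.
Proof. exact: map_mxD. Qed.

Lemma cmxN p q (M : 'M[F]_(p, q)) : cmx (- M) = - cmx M.
Proof. exact: map_mxN. Qed.

Lemma cmx0 p q : cmx (0 : 'M[F]_(p, q)) = 0.
Proof. exact: map_mx0. Qed.

Lemma cmx1 p : cmx (1%:M : 'M[F]_p) = 1%:M.
Proof. exact: map_mx1. Qed.

Lemma tr_cmx p q (M : 'M[F]_(p, q)) : (cmx M)^T = cmx M^T.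
Proof. exact: map_trmx. Qed.

Lemma cmx_Erow x : cmx (Erow F m n x) = E x.
Proof. by apply/matrixP=> i j; rewrite !mxE; case: andP. Qed.

Lemma cmx_Ecol x : cmx (Ecol F m n x) = Ecol K m n x.
Proof. by rewrite -tr_cmx cmx_Erow. Qed.

Definition core (A : 'M[K]_n) (q : nat) : 'M[K]_(m * n) :=
  'X *: cmx (blk m (T1fun m A q)) - cmx (blk m (T0fun m A q)).

Lemma row_core A q x :
  E x *m core A q = 'X *: cmx (Erow F m n x *m blk m (T1fun m A q))
                    - cmx (Erow F m n x *m blk m (T0fun m A q)).
Proof. by rewrite !cmxM cmx_Erow mulmxBr -scalemxAr. Qed.

Lemma mxcoef_tr (A : 'M[K]_n) j : mxcoef A^T j = (mxcoef A j)^T.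
Proof. by apply/matrixP=> u v; rewrite !mxE. Qed.

Lemma tr_hankel (A : 'M[K]_n) p x y : (hankel m A p x y)^T = hankel m A^T p y x.
Proof.
rewrite /hankel [(y < p)%N && _]andbC (addnC y) [y == x]eq_sym.
rewrite (_ : (m + p - 1 - y - x)%N = (m + p - 1 - x - y)%N); last by lia.
by do 2?case: ifP => _; rewrite ?mxcoef_tr ?trmx0 ?trmx1.
Qed.

Lemma tr_T1 (A : 'M[K]_n) q x y : (T1fun m A q x y)^T = T1fun m A^T q y x.
Proof.
rewrite /T1fun [(y <= q)%N || _]orbC.
case: (boolP (_ || _)) => h; first by rewrite tr_hankel.
case: (eqVneq y x) => [->|h1]; first by ifs; rewrite ?trmx0 ?mxcoef_tr.
case: (eqVneq y x.+1) => [->|h2]; first by ifs; rewrite ?trmx1 ?trmx0.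
case: (eqVneq x y.+1) => [->|h3]; first by ifs; rewrite ?trmx1 ?trmx0.
have /negPf h4 : y != x.-1 by lia.
have /negPf h5 : x != y.-1 by lia.
by rewrite h4 h5 !if_same trmx0.
Qed.

Lemma tr_T0 (A : 'M[K]_n) q x y : (T0fun m A q x y)^T = T0fun m A^T q y x.
Proof.
rewrite /T0fun [(y < q)%N || _]orbC.
case: (boolP (_ || _)) => h; first by rewrite tr_hankel.
case: (eqVneq y x) => [->|h1]; first by ifs; rewrite ?trmx0 ?linearN /= ?mxcoef_tr.
case: (eqVneq y x.+1) => [->|h2]; first by ifs; rewrite ?trmx1 ?trmx0.
case: (eqVneq x y.+1) => [->|h3]; first by ifs; rewrite ?trmx1 ?trmx0.
have /negPf h4 : y != x.-1 by lia.
have /negPf h5 : x != y.-1 by lia.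
by rewrite h4 h5 !if_same trmx0.
Qed.

Lemma tr_core A q : (core A q)^T = core A^T q.
Proof.
rewrite /core linearB linearZ /= !tr_cmx !tr_blk.
by congr (_ *: cmx _ - cmx _); apply: eq_blk => x y _ _; rewrite ?tr_T1 ?tr_T0.
Qed.

(** The value after [p] steps of Horner's scheme for [A]. *)
Definition horner_mx (A : 'M[K]_n) (p : nat) : 'M[K]_n :=
  \sum_(y < p) 'X^(p - 1 - y) *: cmx (mxcoef A (m - y)).

Lemma horner_mxS A p :
  horner_mx A p.+1 = 'X *: horner_mx A p + cmx (mxcoef A (m - p)).
Proof.
rewrite /horner_mx big_ord_recr /= scaler_sumr; congr (_ + _).
  apply: eq_bigr => y _; rewrite scalerA -exprS; congr ('X^_ *: _).
  by have := ltn_ord y; lia.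
by rewrite (_ : (p.+1 - 1 - p)%N = 0%N) ?scale1r //; lia.
Qed.

Lemma horner_mx_full A : (forall j, (m < j)%N -> mxcoef A j = 0) ->
  horner_mx A m.+1 = A.
Proof.
move=> hA; apply/matrixP=> i j; rewrite summxE.
apply/polyP => l; rewrite coef_sum.
under eq_bigr => y _ do rewrite !mxE /= coefMC coefXn.
case: (leqP l m) => hl; last first.
  have /matrixP/(_ i j) := hA l hl; rewrite !mxE /= => ->.
  rewrite big1 // => y _; rewrite gtn_eqF ?mul0r //; lia.
have hy : (m - l < m.+1)%N by lia.
rewrite (bigD1 (Ordinal hy)) //= big1 ?addr0 => [|y hne].
  rewrite (_ : (m - (m - l))%N = l); last by lia.
  by rewrite eqn_leq (_ : (l <= _ <= l)%N) ?mul1r //; lia.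
have {}hne : y != (m - l)%N :> nat by [].
by have ltym := ltn_ord y; rewrite (_ : (l == _) = false) ?mul0r //; lia.
Qed.

(** The solution v of T v = e A with last block I.  The block rows of odd type
    force powers of X on the blocks of even type; the rows of even type then
    carry out Horner's scheme on the others. *)
Definition null_vec (A : 'M[K]_n) (q x : nat) : 'M[K]_n :=
  if (x <= q)%N then ('X^(q - x + (m - q)./2))%:M
  else if odd (x + q) then 'X^((m - x)./2) *: horner_mx A x.+1
  else ('X^((m - x)./2))%:M.

Lemma cmx_row_bcol (f : nat -> nat -> 'M[F]_n) x v : (x < m)%N ->
  cmx (Erow F m n x *m blk m f) *m bcol m v = \sum_(y < m) cmx (f x y) *m v y.
Proof.
move=> hx; rewrite row_blk // /cmx (raddf_sum (@map_mx _ _ _ _ _)) /=.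
rewrite mulmx_suml; apply: eq_bigr => y _.
by rewrite -!/(cmx _) cmxM cmx_Erow -mulmxA row_bcol.
Qed.

(** The Hankel parts of T1 and T0 differ by a shift along the block rows, which
    the powers of X in v compensate. *)
Lemma hankel_null A q x : (x < q < m)%N ->
  'X *: (cmx (Erow F m n x *m blk m (hankel m A q.+1)) *m bcol m (null_vec A q))
  = cmx (Erow F m n x *m blk m (hankel m A q)) *m bcol m (null_vec A q).
Proof.
move=> hx; rewrite !cmx_row_bcol; try lia.
pose f y := 'X *: (cmx (hankel m A q.+1 x y) *m null_vec A q y).
pose g y := cmx (hankel m A q x y) *m null_vec A q y.
have fg y : (y.+1 < m)%N -> f y.+1 = g y.
  move=> hy; rewrite /f /g /hankel.
  ifs; rewrite ?cmx0 ?mul0mx ?scaler0 // /null_vec.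
  ifs; rewrite !mul_mx_scalar scalerA -exprS.
  by congr ('X^_ *: cmx (mxcoef A _)); lia.
have f0 : f 0%N = 0.
  by rewrite /f /hankel; ifs; rewrite cmx0 mul0mx scaler0.
have gm : g m.-1 = 0 by rewrite /g /hankel; ifs; rewrite cmx0 mul0mx.
rewrite scaler_sumr -/f -[LHS]/(\sum_(y < m) f y) -[RHS]/(\sum_(y < m) g y).
have -> : m = m.-1.+1 by lia.
rewrite big_ord_recl big_ord_recr /= f0 gm add0r addr0.
by apply: eq_bigr => y _; rewrite fg //; have := ltn_ord y; lia.
Qed.

Lemma T1_null A q x : (q <= x < m)%N -> odd (m + q) -> ~~ odd (x + q) ->
  cmx (Erow F m n x *m blk m (T1fun m A q)) *m bcol m (null_vec A q)
  = 'X^((m - x)./2) *: horner_mx A x.+1.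
Proof.
move=> hx mq px; rewrite row_T1; last by lia.
case: ifP => xq.
  have -> : x = q by lia.
  rewrite cmx_row_bcol; last by lia.
  rewrite scaler_sumr.
  rewrite (big_ord_widen m (fun y => 'X^((m - q)./2) *:
    ('X^(q.+1 - 1 - y) *: cmx (mxcoef A (m - y))))); last by lia.
  rewrite [RHS]big_mkcond /=; apply: eq_bigr => y _.
  rewrite /hankel /null_vec; case: (ltnP y q.+1) => yq; last first.
    by ifs; rewrite cmx0 mul0mx.
  ifs; rewrite mul_mx_scalar scalerA -exprD.
  by congr ('X^_ *: cmx (mxcoef A _)); lia.
rewrite (negPf px) cmxD cmxM !cmx_Erow mulmxDl -mulmxA !row_bcol; try lia.
rewrite /null_vec; ifs; rewrite mul_mx_scalar (_ : x.-1.+1 = x); last by lia.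
rewrite horner_mxS scalerDr scalerA -exprSr.
by rewrite (_ : (m - x.-1)./2 = (m - x)./2.+1) //; lia.
Qed.

(** In the last block row there is no next block; the Horner value is then A
    itself, and it survives as the right-hand side of T v = e A. *)
Lemma next_null A q x : (q <= x < m)%N -> odd (m + q) -> ~~ odd (x + q) ->
  (forall j, (m < j)%N -> mxcoef A j = 0) ->
  E x.+1 *m bcol m (null_vec A q)
  = 'X^((m - x)./2) *: horner_mx A x.+2 - (x == m.-1)%:R%:M *m A.
Proof.
move=> hx mq px hA; case: (ltnP x.+1 m) => xm.
  rewrite row_bcol // (_ : (x == m.-1) = false); last by lia.
  rewrite raddf0 mul0mx subr0 /null_vec; ifs.
  by rewrite (_ : (m - x.+1)./2 = (m - x)./2) //; lia.
rewrite Erow_out // mul0mx (_ : x == m.-1); last by lia.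
rewrite (_ : (m - x)./2 = 0%N); last by lia.
rewrite (_ : x.+2 = m.+1); last by lia.
by rewrite horner_mx_full // scale1r mul1mx subrr.
Qed.

Lemma core_null A q : (q < m)%N -> odd (m + q) ->
  (forall j, (m < j)%N -> mxcoef A j = 0) ->
  core A q *m bcol m (null_vec A q) = Ecol K m n m.-1 *m A.
Proof.
move=> qm mq hA; apply: eq_rows => x hx.
rewrite !mulmxA Erow_Ecol // row_core mulmxBl -scalemxAl.
case: (ltnP x q) => xq.
  rewrite row_T1 // row_T0 // ifT; last by lia.
  rewrite xq (_ : (x == m.-1) = false); last by lia.
  by rewrite raddf0 mul0mx hankel_null ?subrr //; lia.
case: (boolP (odd (x + q))) => px; last first.
  rewrite T1_null ?xq // row_T0 //; ifs.
  rewrite cmxD cmxM cmxN !cmx_Erow mulmxDl -mulmxA (next_null _ mq px hA) ?xq //.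
  rewrite row_bcol // (_ : null_vec A q x = ('X^((m - x)./2))%:M); last first.
    by rewrite /null_vec; ifs; congr (('X^_)%:M); lia.
  rewrite (_ : (m - 1 - x)%N = (m - x.+1)%N); last by lia.
  rewrite mulNmx mul_mx_scalar (horner_mxS A x.+1).
  rewrite [in X in _ - (_ + (X - _))]scalerDr !scalerA [_ * 'X]mulrC.
  have cancel4 (V : zmodType) (u b d : V) : u - (- b + (u + b - d)) = d.
    by rewrite opprD opprK opprB addrA addrC subrK.
  exact: cancel4.
rewrite row_T1 // row_T0 //; ifs.
rewrite !cmx_Erow !row_bcol; try lia.
rewrite (_ : (x == m.-1) = false); last by lia.
rewrite raddf0 mul0mx /null_vec; ifs.
  rewrite scale_scalar_mx -exprS -raddfB /=.
  rewrite (_ : (m - x.+1)./2.+1 = (q - x.-1 + (m - q)./2)%N) ?subrr ?raddf0 //.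
  lia.
rewrite scale_scalar_mx -exprS -raddfB /=.
rewrite (_ : (m - x.+1)./2.+1 = ((m - x.-1)./2)%N) ?subrr ?raddf0 //.
lia.
Qed.

End CorePoly.

Section RowSpan.
Variables (S : comUnitRingType) (p q r : nat) (M : 'M[S]_(q, r)).

Definition rowspan (W : 'M[S]_(p, r)) : Prop := exists Y, Y *m M = W.

Lemma rowspan0 : rowspan 0.
Proof. by exists 0; rewrite mul0mx. Qed.

Lemma rowspanD W W' : rowspan W -> rowspan W' -> rowspan (W + W').
Proof. by case=> Y <- [Y' <-]; exists (Y + Y'); rewrite mulmxDl. Qed.

Lemma rowspanN W : rowspan W -> rowspan (- W).
Proof. by case=> Y <-; exists (- Y); rewrite mulNmx. Qed.

Lemma rowspanB W W' : rowspan W -> rowspan W' -> rowspan (W - W').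
Proof. by move=> h /rowspanN h'; apply: rowspanD. Qed.

Lemma rowspan_mul (X : 'M[S]_p) W : rowspan W -> rowspan (X *m W).
Proof. by case=> Y <-; exists (X *m Y); rewrite mulmxA. Qed.

Lemma rowspanZ (s : S) W : rowspan W -> rowspan (s *: W).
Proof. by case=> Y <-; exists (s *: Y); rewrite scalemxAl. Qed.

Lemma rowspan_sum (I : finType) (P : pred I) (W : I -> 'M[S]_(p, r)) :
  (forall i, P i -> rowspan (W i)) -> rowspan (\sum_(i | P i) W i).
Proof. by move=> h; elim/big_ind: _ => //; [exact: rowspan0 | exact: rowspanD]. Qed.

End RowSpan.

Section Linearization.
Variables (F : fieldType) (m n : nat) (A : 'M[{poly F}]_n) (q : nat).
Local Notation K := {poly F}.
Local Notation E := (@Erow K m n).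
Local Notation C := (@Ecol K m n).
Local Notation a := (mxcoef A).
Local Notation T := (core m A q).
Hypotheses (qm : (q < m)%N) (mq : odd (m + q)).
Hypothesis hA : forall j, (m < j)%N -> mxcoef A j = 0.

Definition proj_last : 'M[K]_(m * n) := 1%:M - C m.-1 *m E m.-1.

(** The core pencil with its last block row and column replaced by those of the
    identity: keeping the size avoids submatrices, and invertibility is that of
    the leading blocks. *)
Definition core_minor : 'M[K]_(m * n) :=
  proj_last *m T *m proj_last + C m.-1 *m E m.-1.

(** diag(I, ..., I, A) *)
Definition diag_last : 'M[K]_(m * n) :=
  1%:M + C m.-1 *m (A - 1%:M) *m E m.-1.

Lemma Erow_last : E m.-1 *m C m.-1 = 1%:M.
Proof. by rewrite Erow_Ecol ?eqxx //; lia. Qed.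

Lemma Erow_last0 x : (x < m.-1)%N -> E x *m C m.-1 = 0.
Proof. by move=> hx; rewrite Erow_Ecol ?ltn_eqF ?raddf0 //; lia. Qed.

Lemma row_proj_last x : (x < m.-1)%N -> E x *m proj_last = E x.
Proof.
move=> hx; rewrite /proj_last mulmxBr mulmx1 mulmxA Erow_last0 //.
by rewrite mul0mx subr0.
Qed.

Lemma last_proj_last : E m.-1 *m proj_last = 0.
Proof. by rewrite mulmxBr mulmx1 mulmxA Erow_last mul1mx subrr. Qed.

Lemma proj_last_col : proj_last *m C m.-1 = 0.
Proof. by rewrite mulmxBl mul1mx -mulmxA Erow_last mulmx1 subrr. Qed.

Lemma row_last_minor : E m.-1 *m core_minor = E m.-1.
Proof.
rewrite /core_minor mulmxDr !mulmxA last_proj_last !mul0mx add0r.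
by rewrite Erow_last mul1mx.
Qed.

Lemma minor_col_last : core_minor *m C m.-1 = C m.-1.
Proof.
rewrite /core_minor mulmxDl -!mulmxA proj_last_col !mulmx0 add0r.
by rewrite Erow_last mulmx1.
Qed.

Lemma row_minor x : (x < m.-1)%N ->
  E x *m core_minor = E x *m T - E x *m T *m C m.-1 *m E m.-1.
Proof.
move=> hx; rewrite /core_minor mulmxDr !mulmxA row_proj_last // Erow_last0 //.
rewrite mul0mx addr0.
by rewrite /proj_last mulmxBr mulmx1 !mulmxA.
Qed.

Local Notation span := (@rowspan _ n _ _ core_minor).

Lemma span_last : span (E m.-1).
Proof. by exists (E m.-1); rewrite row_last_minor. Qed.

Lemma span_core x : (x < m.-1)%N -> span (E x *m T).
Proof.
move=> hx; rewrite -[E x *m T](subrK (E x *m T *m C m.-1 *m E m.-1)).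
apply: rowspanD; first by rewrite -row_minor //; exists (E x).
by apply: rowspan_mul; exact: span_last.
Qed.

(** A block row x of odd type is X E_(x+1) - E_(x-1), so the rows of even type are
    reached downwards from the last one. *)
Lemma span_even j : (q + 2 * j < m)%N -> span (E (m.-1 - 2 * j)).
Proof.
elim: j => [|j IH] hj; first by rewrite subn0; exact: span_last.
have := @span_core (m.-1 - 2 * j).-1 ltac:(lia).
rewrite row_core row_T1; try lia; rewrite row_T0; try lia; ifs.
rewrite !cmx_Erow (_ : (m.-1 - 2 * j).-1.+1 = m.-1 - 2 * j)%N; last by lia.
rewrite (_ : (m.-1 - 2 * j).-1.-1 = m.-1 - 2 * j.+1)%N; last by lia.
move=> h; have /(rowspanZ 'X) h1 := IH ltac:(lia).
by have := rowspanB h1 h; rewrite subKr.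
Qed.

Lemma cmx_row_blk (f : nat -> nat -> 'M[F]_n) x : (x < m)%N ->
  cmx (Erow F m n x *m blk m f) = \sum_(y < m) cmx (f x y) *m E y.
Proof.
move=> hx; rewrite row_blk // /cmx (raddf_sum (@map_mx _ _ _ _ _)) /=.
by apply: eq_bigr => y _; rewrite -!/(cmx _) cmxM cmx_Erow.
Qed.

Definition elim_col : 'M[K]_(m * n) :=
  1%:M + (bcol m (null_vec m A q) - C m.-1) *m E m.-1.

Definition elim_row : 'M[K]_(m * n) :=
  1%:M + C m.-1 *m ((bcol m (null_vec m A^T q))^T - E m.-1).

Lemma null_vec_last B : E m.-1 *m bcol m (null_vec m B q) = 1%:M.
Proof.
rewrite row_bcol /null_vec; last by lia.
ifs; first by rewrite (_ : (q - m.-1 + (m - q)./2)%N = 0%N) //; lia.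
by rewrite (_ : (m - m.-1)./2 = 0%N) //; lia.
Qed.

Lemma elim_col_unit : elim_col \in unitmx.
Proof.
set N := (bcol m (null_vec m A q) - C m.-1) *m E m.-1.
suff /mulmx1_unit[] : elim_col *m (1%:M - N) = 1%:M by [].
have NN : N *m N = 0.
  rewrite /N -mulmxA [E _ *m (_ *m _)]mulmxA mulmxBr null_vec_last Erow_last.
  by rewrite subrr mul0mx mulmx0.
by rewrite mulmxDl mul1mx mulmxBr mulmx1 NN subr0 subrK.
Qed.

Local Notation null_row := (bcol m (null_vec m A^T q))^T.

Lemma null_row_last : null_row *m C m.-1 = 1%:M.
Proof. by rewrite -trmx_mul null_vec_last trmx1. Qed.

Lemma elim_row_unit : elim_row \in unitmx.
Proof.
set N := C m.-1 *m (null_row - E m.-1).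
suff /mulmx1_unit[] : elim_row *m (1%:M - N) = 1%:M by [].
have NN : N *m N = 0.
  rewrite /N -mulmxA [(_ - _) *m (_ *m _)]mulmxA mulmxBl null_row_last Erow_last.
  by rewrite subrr mul0mx mulmx0.
by rewrite mulmxDl mul1mx mulmxBr mulmx1 NN subr0 subrK.
Qed.

Lemma elim_row_last : elim_row *m C m.-1 = C m.-1.
Proof.
by rewrite mulmxDl mul1mx -mulmxA mulmxBl Erow_last null_row_last subrr mulmx0 addr0.
Qed.

Lemma last_elim_col : E m.-1 *m elim_col = E m.-1.
Proof.
rewrite mulmxDr mulmx1 mulmxA mulmxBr Erow_last null_vec_last.
by rewrite subrr mul0mx addr0.
Qed.

Lemma null_core : (bcol m (null_vec m A^T q))^T *m T = A *m E m.-1.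
Proof.
apply: trmx_inj; rewrite trmx_mul trmxK tr_core core_null //.
  by rewrite trmx_mul.
by move=> j hj; rewrite mxcoef_tr hA // trmx0.
Qed.

Lemma elim_core : elim_row *m T *m elim_col =
  core_minor *m diag_last.
Proof.
apply: eq_rows => x hx; rewrite !mulmxA.
have row_diag W : W *m diag_last = W + W *m C m.-1 *m (A - 1%:M) *m E m.-1.
  by rewrite mulmxDr mulmx1 !mulmxA.
case: (ltnP x m.-1) => hx1; last first.
  have -> : x = m.-1 by lia.
  rewrite row_last_minor row_diag Erow_last mul1mx.
  have -> : E m.-1 *m elim_row = null_row.
    by rewrite mulmxDr mulmx1 mulmxA Erow_last mul1mx addrC subrK.
  by rewrite null_core -mulmxA last_elim_col addrC mulmxBl mul1mx subrK.
rewrite row_minor // row_diag.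
have -> : E x *m elim_row = E x.
  by rewrite mulmxDr mulmx1 mulmxA Erow_last0 // mul0mx addr0.
have -> : E x *m T *m elim_col = E x *m T + (0 - E x *m T *m C m.-1) *m E m.-1.
  rewrite /elim_col mulmxDr mulmx1 mulmxA [_ *m (bcol _ _ - _)]mulmxBr.
  by rewrite -[_ *m T *m bcol _ _]mulmxA core_null // mulmxA Erow_last0 // mul0mx.
have -> : (E x *m T - E x *m T *m C m.-1 *m E m.-1) *m C m.-1 = 0.
  by rewrite mulmxBl -[_ *m E _ *m C _]mulmxA Erow_last mulmx1 subrr.
by rewrite !mul0mx addr0 sub0r mulNmx.
Qed.

Hypothesis aq : a m \notin unitmx -> q = 0%N.

(** In the Hankel part the first nonzero block of a row is -a_m, which is where
    the invertibility of the leading coefficient enters. *)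
Lemma span_hankel j : (j <= q)%N -> span (E (q - j)).
Proof.
elim/ltn_ind: j => j IH hj.
case: (posnP j) => [->|j0].
  have := @span_even ((m - q)./2) ltac:(lia).
  by rewrite (_ : m.-1 - 2 * (m - q)./2 = q - 0)%N //; lia.
have am : a m \in unitmx by apply/negPn/negP => /aq; lia.
have := @span_core (j - 1)%N ltac:(lia).
rewrite row_core row_T1; try lia; rewrite row_T0; try lia; ifs.
rewrite !cmx_row_blk; try lia.
rewrite scaler_sumr -sumrB.
have hy : (q - j < m)%N by lia.
rewrite (bigD1 (Ordinal hy)) //= => h.
have {h} : span ('X *: (cmx (hankel m A q.+1 (j - 1) (q - j)) *m E (q - j)) -
     cmx (hankel m A q (j - 1) (q - j)) *m E (q - j)).
  move: h; set W := (X in span (_ + X)) => h.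
  rewrite -[X in span X](addrK W); apply: rowspanB => //.
  apply: rowspan_sum => y; rewrite -val_eqE /= => ne.
  case: (ltnP y (q - j)) => hyj.
    rewrite /hankel; ifs; rewrite !cmx0 !mul0mx scaler0 subr0; exact: rowspan0.
  case: (leqP y q) => hyq.
    have hs : span (E y).
      have := IH (q - y)%N ltac:(lia) ltac:(lia).
      by rewrite (_ : (q - (q - y))%N = y) //; lia.
    by apply: rowspanB; [apply: rowspanZ|]; apply: rowspan_mul.
  rewrite /hankel; ifs; rewrite !cmx0 !mul0mx scaler0 subr0; exact: rowspan0.
rewrite {1}/hankel; ifs; rewrite cmx0 mul0mx scaler0 sub0r => /rowspanN.
rewrite opprK /hankel; ifs.
rewrite (_ : (m + q - 1 - (j - 1) - (q - j))%N = m); last by lia.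
move/(rowspan_mul (cmx (invmx (a m)))).
by rewrite mulmxA -cmxM mulVmx // cmx1 mul1mx.
Qed.

(** A block row x of even type contains E_(x+1) with coefficient -1, next to block
    rows already reached and, for x > q, to E_(x-1). *)
Lemma span_odd j : (q + 2 * j + 1 < m)%N -> span (E (q + 2 * j + 1)).
Proof.
elim: j => [|j IH] hj.
  have := @span_core q ltac:(lia).
  rewrite row_core row_T1; try lia; rewrite row_T0; try lia; ifs.
  rewrite cmxD cmxM !cmx_Erow cmx_row_blk // muln0 addn0 addn1 => h.
  have h1 : span ('X *: (\sum_(y < m) cmx (hankel m A q.+1 q y) *m E y)).
    apply/rowspanZ/rowspan_sum => y _; case: (leqP y q) => hy.
      have := @span_hankel (q - y)%N ltac:(lia).
      by rewrite (_ : (q - (q - y))%N = y); [exact: rowspan_mul|lia].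
    rewrite /hankel; ifs; rewrite cmx0 mul0mx; exact: rowspan0.
  have h2 : span (cmx (- a (m - 1 - q)) *m E q).
    by apply: rowspan_mul; have := @span_hankel 0%N isT; rewrite subn0.
  have := rowspanB (rowspanB h1 h) h2.
  by rewrite subKr addrC addKr.
have hev y : (q <= y < m)%N -> ~~ odd (y + q) -> span (E y).
  move=> hy py; have := @span_even ((m.-1 - y)./2) ltac:(lia).
  by rewrite (_ : (m.-1 - 2 * (m.-1 - y)./2)%N = y) //; lia.
have := @span_core (q + 2 * j.+1)%N ltac:(lia).
rewrite row_core row_T1; try lia; rewrite row_T0; try lia; ifs.
rewrite !cmxD !cmxM !cmx_Erow => h.
have h0 : span (E (q + 2 * j.+1)) by apply: hev; lia.
have h1 : span ('X *: (E (q + 2 * j.+1).-1 +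
    cmx (a (m - (q + 2 * j.+1))) *m E (q + 2 * j.+1))).
  apply/rowspanZ/rowspanD; last exact: rowspan_mul.
  rewrite (_ : (q + 2 * j.+1).-1 = q + 2 * j + 1)%N; last by lia.
  by apply: IH; lia.
have h2 := rowspan_mul (cmx (- a (m - 1 - (q + 2 * j.+1)))) h0.
have := rowspanB (rowspanB h1 h) h2.
by rewrite subKr addrC addKr addn1.
Qed.

Lemma core_minor_unit : core_minor \in unitmx.
Proof.
apply: unitmx_span => x hx; change (span (E x)).
case: (leqP x q) => xq.
  have := @span_hankel (q - x)%N ltac:(lia).
  by rewrite (_ : (q - (q - x))%N = x) //; lia.
case: (boolP (odd (x + q))) => px.
  have := @span_odd ((x - q)./2) ltac:(lia).
  by rewrite (_ : q + 2 * (x - q)./2 + 1 = x)%N //; lia.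
have := @span_even ((m.-1 - x)./2) ltac:(lia).
by rewrite (_ : (m.-1 - 2 * (m.-1 - x)./2)%N = x) //; lia.
Qed.

End Linearization.

(** * Consecutions and inversions at 0 *)

(** Entries that differ by at most one are never interchanged. *)
Lemma swap_equiv_filter (P : pred int) s t :
  (forall i j, P i -> P j -> `|i - j| <= 1) -> swap_equiv s t ->
  filter P s = filter P t.
Proof.
move=> hP; elim=> [//|s1 s2 u i j d _ <-].
rewrite !filter_cat /=; case Pi: (P i); case Pj: (P j) => //.
by have := hP _ _ Pi Pj; rewrite leNgt d.
Qed.

Lemma simple_even_index h w q : ~~ odd h -> simple_admissible h w q -> q = 0%N.
Proof. by move=> he [[_ hq ho _] [//|hq1]]; subst q; lia. Qed.

Lemma admissible_csfE p q : admissible_csf p q = pairs q (p - q)./2 ++ range 0 q.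
Proof. by []. Qed.

Lemma symm_complE p q : symm_compl p q = odds q (p - q)./2 ++ rev_c q.
Proof. by []. Qed.

Section ZeroRuns.
Variables (k : nat) (w : seq int).
Hypothesis sw : swap_equiv w (pairs 0 k.+1 ++ [:: 0]).

Lemma pairs_filter (P : pred int) :
  (forall j, (2 < j)%N -> ~~ P (Posz j)) ->
  filter P (pairs 0 k.+1 ++ [:: 0]) = filter P [:: 1; 2; 0].
Proof.
move=> hP; rewrite filter_cat.
suff -> : filter P (pairs 0 k.+1) = filter P [:: 1; 2] by rewrite -filter_cat.
elim: k => [//|l IH].
by rewrite pairsS [LHS]/= IH !ifN ?hP //; lia.
Qed.

Lemma filter01 : filter (mem [:: 0; 1]) w = [:: 1; 0].
Proof.
rewrite (swap_equiv_filter _ sw) ?pairs_filter //.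
  by move=> j hj; rewrite !inE; lia.
by move=> i j; rewrite !inE => /orP[]/eqP-> /orP[]/eqP->.
Qed.

Lemma filter12 : filter (mem [:: 1; 2]) w = [:: 1; 2].
Proof.
rewrite (swap_equiv_filter _ sw) ?pairs_filter //.
  by move=> j hj; rewrite !inE; lia.
by move=> i j; rewrite !inE => /orP[]/eqP-> /orP[]/eqP->.
Qed.

Lemma subseq10 : subseq [:: 1; 0] w.
Proof. by rewrite -filter01 filter_subseq. Qed.

Lemma not_subseq01 : ~~ subseq [:: 0; 1] w.
Proof.
apply/negP => h; have : subseq [:: 0; 1] (filter (mem [:: 0; 1]) w).
  by rewrite subseq_filter h.
by rewrite filter01.
Qed.

Lemma not_subseq21 : ~~ subseq [:: 2; 1] w.
Proof.
apply/negP => h; have : subseq [:: 2; 1] (filter (mem [:: 1; 2]) w).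
  by rewrite subseq_filter h.
by rewrite filter12.
Qed.

Lemma subseq_range_trans u s : (1 < s)%N ->
  subseq (range 0 s) u -> subseq [:: 0; 1; 2] u.
Proof.
case: s => [|[|s]] // _; apply: subseq_trans.
by rewrite /range /= sub0seq.
Qed.

Lemma i0_pairs : i0 w = 1%N.
Proof.
apply/eqP; rewrite eqn_leq; apply/andP; split.
  apply/bigmax_leqP => s; rewrite leqNgt => hs; apply/negP => s1.
  case/negP: not_subseq21; apply: subseq_trans hs.
  rewrite -[X in subseq X]revK subseq_rev.
  by apply: subseq_trans (@subseq_range_trans _ _ s1 (subseq_refl _)).
have sz : (1 < size w)%N by have := size_subseq subseq10.
by rewrite (@leq_bigmax_cond _ _ _ (Ordinal sz)) //= subseq10.
Qed.

Lemma subseq_notin (x : int) s b u : x \notin b ->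
  subseq (x :: s) (b ++ u) -> subseq (x :: s) u.
Proof. by elim: b => //= y b IH; rewrite inE negb_or => /andP[/negPf->]. Qed.

Lemma c0_pairs : c0 (w ++ odds 0 k.+1) = 1%N.
Proof.
have w0 : 0 \in w by rewrite (mem_subseq subseq10) // !inE.
have c1 : 1 \in odds 0 k.+1.
  elim: k => [//|l IH]; by rewrite oddsS inE IH orbT.
have s01 : subseq [:: 0; 1] (w ++ odds 0 k.+1).
  by rewrite -[[:: 0; 1]]/([:: 0] ++ [:: 1]) cat_subseq // sub1seq.
apply/eqP; rewrite eqn_leq; apply/andP; split.
  apply/bigmax_leqP => s; rewrite leqNgt => hs; apply/negP => s1.
  have := subseq_range_trans s1 hs.
  rewrite -subseq_rev rev_cat => /subseq_notin h.
  have {h} : subseq (rev [:: 0; 1; 2]) (rev w).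
    apply: h; rewrite mem_rev; apply/negP => /mem_odds[j]; lia.
  rewrite subseq_rev => /(subseq_trans _) h; case/negP: not_subseq01.
  exact: h.
have sz : (1 < size (w ++ odds 0 k.+1))%N by have := size_subseq s01.
by rewrite (@leq_bigmax_cond _ _ _ (Ordinal sz)) //= s01.
Qed.

End ZeroRuns.

Lemma zero_runs h w q : ~~ odd h -> simple_admissible h w q ->
  i0 w = (0 < h)%N /\ c0 (w ++ symm_compl h q) = (0 < h)%N.
Proof.
move=> he hw; have q0 := simple_even_index he hw; subst q.
case: hw => [[pw _ _ [_ sw]] _].
rewrite symm_complE /rev_c /= cats0 subn0.
move: sw; rewrite admissible_csfE subn0 -[range 0 0]/[:: 0].
case: (posnP h) => [h0|h0].
  subst h => _; have [-> ->] : w = [:: 0] /\ odds 0 0 = [::].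
    by split=> //; apply: perm_small_eq pw.
  have mx0 (P : pred 'I_1) : (\max_(s < 1 | P s) s = 0)%N.
    by rewrite big1 // => s _; rewrite ord1.
  by split; apply: mx0.
have -> : h./2 = (h./2.-1).+1 by lia.
by move=> sw; rewrite (i0_pairs sw) (c0_pairs sw).
Qed.

(** * T-even pencils *)

Section TEven.
Variable F : fieldType.

Lemma coef_comp_opp (p : {poly F}) j : (p \Po (- 'X))`_j = (-1) ^+ j * p`_j.
Proof.
rewrite comp_polyE coef_sum.
under eq_bigr => i _ do rewrite coefZ exprNn -polyCN -polyC_exp coefCM coefXn.
case: (ltnP j (size p)) => hj; last first.
  rewrite [p`_j]nth_default // mulr0 big1 // => i _.
  by rewrite gtn_eqF ?mulr0 // (leq_trans (ltn_ord i)).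
rewrite (bigD1 (Ordinal hj)) //= eqxx mulr1 mulrC big1 ?addr0 // => i hi.
have /negPf e : i != j :> nat by [].
by rewrite eq_sym e mulr0 mulr0.
Qed.

Lemma mxcoef_opp n (P : 'M[{poly F}]_n) j :
  mxcoef (map_mx (fun p => p \Po (- 'X)) P)^T j = (-1) ^+ j *: (mxcoef P j)^T.
Proof. by apply/matrixP=> u v; rewrite !mxE /= coef_comp_opp. Qed.

Lemma T_even_coef n (P : 'M[{poly F}]_n) j :
  T_even P -> (mxcoef P j)^T = (-1) ^+ j *: mxcoef P j.
Proof.
move=> eP; rewrite -[in RHS]eP mxcoef_opp scalerA -exprD addnn -mul2n.
by rewrite exprM sqrrN expr1n expr1n scale1r.
Qed.

Lemma pencil_coef n (M N : 'M[F]_n) j :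
  mxcoef ('X *: cmx M - cmx N) j = (j == 1%N)%:R *: M - (j == 0%N)%:R *: N.
Proof.
apply/matrixP=> u v; rewrite !mxE /= coefB coefMC coefX coefC.
by case: (j == 0%N); rewrite ?mul1r ?mul0r.
Qed.

Lemma mxcoefP p q (M N : 'M[{poly F}]_(p, q)) :
  (forall j, mxcoef M j = mxcoef N j) -> M = N.
Proof.
move=> h; apply/matrixP=> u v; apply/polyP=> j.
by have /matrixP/(_ u v) := h j; rewrite !mxE.
Qed.

Lemma T_even_pencil n (M N : 'M[F]_n) :
  T_even ('X *: cmx M - cmx N) <-> M^T = - M /\ N^T = N.
Proof.
split=> [eP|[eM eN]].
  have := T_even_coef 1 eP; have := T_even_coef 0 eP.
  rewrite !pencil_coef /= !scale0r !scale1r sub0r subr0 linearN /= expr1.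
  by rewrite scaleN1r => /oppr_inj-> ->.
apply: mxcoefP => j; rewrite mxcoef_opp pencil_coef linearB !linearZ /= eM eN.
case: j => [|[|j]] /=; rewrite ?scale0r ?scale1r ?oppr0 ?add0r //.
  by rewrite !addr0 expr1 scaleN1r opprK.
by rewrite scaler0.
Qed.

End TEven.

Section QuasiIdentity.
Variables (F : fieldType) (m n : nat).

Lemma sgmx_tens (s : nat -> F) :
  sgmx m n s = diag_mx (\row_j s j) *t (1%:M : 'M_n).
Proof.
apply/matrixP=> i j; case: (mxtens_indexP i) => a b; case: (mxtens_indexP j) => c d.
rewrite tensmxE !mxE !mxtens_indexK (can_eq (@mxtens_indexK _ _)) xpair_eqE.
by case: (a =P c) => [->|_] /=; case: (b =P d) => _; rewrite ?mulr1 ?mulr0 ?mul0r.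
Qed.

Lemma eq_sgmx (s t : nat -> F) : (forall x, (x < m)%N -> s x = t x) ->
  sgmx m n s = sgmx m n t.
Proof.
move=> h; rewrite !sgmx_tens; congr (diag_mx _ *t _).
by apply/rowP=> j; rewrite !mxE h.
Qed.

Lemma quasi_identityP (Q : 'M[F]_(m * n)) : quasi_identity Q <->
  exists2 s : nat -> F, (forall x, s x = 1 \/ s x = -1) & Q = sgmx m n s.
Proof.
split=> [[eps [he ->]]|[s hs ->]].
  exists (fun x => oapp (fun i : 'I_m => eps 0 i) 1 (insub x)).
    by move=> x; case: insubP => [i _ _|_] /=; [exact: he | left].
  rewrite sgmx_tens; congr (diag_mx _ *t _); apply/rowP=> j.
  by rewrite !mxE valK.
by exists (\row_j s j); rewrite sgmx_tens; split=> // i; rewrite mxE.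
Qed.

Lemma sgmx_sqr (s : nat -> F) : (forall x, s x = 1 \/ s x = -1) ->
  sgmx m n s *m sgmx m n s = 1%:M.
Proof.
move=> hs; rewrite sgmxM sgmx_id // => x _.
by case: (hs x) => ->; rewrite ?mulrNN mulr1.
Qed.

End QuasiIdentity.

(** * One diagonal block *)

Section DiagonalBlock.
Variables (F : fieldType) (m n : nat) (A : 'M[{poly F}]_n).
Variables (h : nat) (w zh : seq int) (qw q : nat).
Hypotheses (hh : (h < m)%N) (he : ~~ odd h).
Hypothesis hw : simple_admissible h w qw.
Hypothesis hz : admissible (m - h - 1) (shift zh m%:Z) q.

Local Notation Mt := (tuple_mx m A).
Local Notation c := (m - h - 1)%N.
Local Notation ku := ((c - q)./2).
Local Notation kl := (h./2).
Local Notation G := (blk m (Gfun m A q c)).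
Local Notation T1 := (blk m (T1fun m A q)).
Local Notation T0 := (blk m (T0fun m A q)).
Local Notation L1 := (G *m T1 *m G).
Local Notation L0 := (G *m T0 *m G).
Local Notation cw := (symm_compl h qw).
Local Notation czh := (shift (symm_compl c q) (- m%:Z)).

Lemma index_bounds :
  [/\ (q <= c)%N, c = (q + 2 * ku)%N & m = (c + 2 * kl).+1].
Proof. by case: hz => _ h1 h2 _; split=> //; lia. Qed.

Lemma tuple_w : Mt w = Mt (odds 0 kl) *m Mt (evens 0 kl ++ [:: 0]).
Proof.
have q0 := simple_even_index he hw; case: hw => [[pw _ _ [_ sw]] _].
rewrite (@tuple_mx_swap _ _ _ A _ _ true _ sw).
  rewrite admissible_csfE q0 subn0 !tuple_mx_cat mulmxA; congr (_ *m _).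
  rewrite -[pairs _ _]shift0 (@pairs_split _ _ _ A _ _ _ true) ?shift0 // => i hi.
  by rewrite addr0; lia.
by move=> i; rewrite (perm_mem pw) => /mem_range[j -> hj]; lia.
Qed.

Lemma tuple_cw : Mt cw = Mt (odds 0 kl).
Proof. by rewrite (simple_even_index he hw) symm_complE subn0 /rev_c /= cats0. Qed.

Lemma tuple_zh : Mt zh = Mt (shift (odds q ku) (- m%:Z)) *m
  Mt (shift (evens q ku) (- m%:Z)) *m Mt (shift (range 0 q) (- m%:Z)).
Proof.
have [qc ec em] := index_bounds.
case: hz => [pz _ _ [_ /(swap_equiv_shift (- m%:Z))]]; rewrite shiftK => sz.
rewrite (@tuple_mx_swap _ _ _ A _ _ false _ sz).
  rewrite admissible_csfE shift_cat tuple_mx_cat (@pairs_split _ _ _ A _ _ _ false) //.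
  by move=> i hi; lia.
rewrite -[zh](shiftK m%:Z) => i /mapP[l].
by rewrite (perm_mem pz) => /mem_range[j -> hj] ->; lia.
Qed.

Lemma tuple_czh : Mt czh = Mt (shift (odds q ku) (- m%:Z)) *m
  Mt (shift (rev_c q) (- m%:Z)).
Proof. by rewrite symm_complE shift_cat tuple_mx_cat. Qed.

Lemma fiedler_pencilE : fiedler_pencil m A zh w cw czh =
  'X *: cmx L1 - cmx L0.
Proof.
have [qc ec em] := index_bounds.
rewrite /fiedler_pencil tuple_w tuple_cw tuple_zh tuple_czh.
rewrite !mulmxBl -!scalemxAl -!cmxM.
by rewrite -(L1_factor A ec em) -(L0_factor A ec em).
Qed.

Lemma fiedler_core : fiedler_pencil m A zh w cw czh =
  cmx G *m core m A q *m cmx G.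
Proof.
by rewrite fiedler_pencilE !cmxM /core mulmxBr mulmxBl -!scalemxAr -!scalemxAl.
Qed.

Local Notation i := (nat_of_bool (0 < h)%N).

(** This offset makes the sign of the block row that meets B equal to 1. *)
Definition sign_offset : nat :=
  (core_exp q 0 (m - 1 - i) + (c < m - 1 - i))%N.

Local Notation s := (pencil_sign F q c sign_offset).
Local Notation Q := (sgmx m n s).

Lemma sign_pm x : s x = 1 \/ s x = -1.
Proof. by rewrite /pencil_sign -signr_odd; case: odd; [right | left]. Qed.

Lemma sign_norm : s (m - 1 - i) = 1.
Proof.
rewrite /pencil_sign /sign_offset /core_exp add0n -addnA addnn -mul2n exprM.
by rewrite sqrrN expr1n expr1n.
Qed.

Lemma scale_pencil (M : 'M[F]_(m * n)) : cmx M *m fiedler_pencil m A zh w cw czh =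
  'X *: cmx (M *m L1) - cmx (M *m L0).
Proof. by rewrite fiedler_pencilE mulmxBr -scalemxAr -!cmxM. Qed.

Local Notation K := {poly F}.
Local Notation E := (@Erow K m n).
Local Notation C := (@Ecol K m n).

Lemma G_unit : G \in unitmx.
Proof.
have [qc ec em] := index_bounds.
apply: unitmx_span => x hx.
have R := @row_G F m n A q c.
case: (boolP (q <= x < c)%N) => h1.
  case: (boolP (odd (x + q))) => px.
    by exists (Erow F m n x.-1); rewrite R; try lia; ifs; congr Erow; lia.
  exists (Erow F m n x.+1 - mxcoef A (m - x.+1) *m Erow F m n x).
  rewrite mulmxBl -mulmxA !R; try lia; ifs.
  by rewrite addrK.
case: (ltnP c x) => h2; last by exists (Erow F m n x); rewrite R; ifs.
case: (boolP (odd (x + q))) => px.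
  by exists (Erow F m n x.+1); rewrite R; try lia; ifs.
exists (Erow F m n x.-1 + mxcoef A (m - 1 - x.-1) *m Erow F m n x).
rewrite mulmxDl -mulmxA !R; try lia; ifs.
by rewrite mulNmx (_ : x.-1.+1 = x); [rewrite addrAC addNr add0r | lia].
Qed.

Lemma row_last_G : Erow F m n m.-1 *m G = Erow F m n (m - 1 - i).
Proof.
have [qc ec em] := index_bounds.
by rewrite row_G; try lia; ifs; congr Erow; lia.
Qed.

Lemma G_col_last : G *m Ecol F m n m.-1 = Ecol F m n (m - 1 - i).
Proof.
have [qc ec em] := index_bounds.
apply: eq_rows => x hx; rewrite mulmxA row_blk_col; try lia.
rewrite Erow_Ecol // /Gfun.
case: (boolP (x == (m - 1 - i)%N)) => hx1; last by rewrite raddf0; ifs.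
by ifs; lia.
Qed.

(** The eliminations act trivially on the last block, so the block row and column
    that carry B move only through G, and their sign is [sign_norm]. *)
Lemma block_linearization :
  (forall j, (m < j)%N -> mxcoef A j = 0) ->
  (mxcoef A m \notin unitmx -> q = 0%N) -> exists U V : 'M[K]_(m * n),
  [/\ U \in unitmx, V \in unitmx,
      U *m (cmx Q *m fiedler_pencil m A zh w cw czh) *m V = diag_last m A,
      U *m C (m - 1 - i) = C m.-1 & E (m - 1 - i) *m V = E m.-1].
Proof.
move=> hdeg aq.
have [qc ec em] := index_bounds.
have qm : (q < m)%N by lia.
have mq : odd (m + q) by lia.
have cG : cmx G \in unitmx by rewrite map_unitmx G_unit.
have uK := core_minor_unit qm mq aq.
exists (invmx (core_minor m A q) *m elim_row m A q *m invmx (cmx G) *m cmx Q).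
exists (invmx (cmx G) *m elim_col m A q).
have QQ : cmx Q *m cmx Q = 1%:M by rewrite -cmxM sgmx_sqr ?cmx1 //; exact: sign_pm.
have uQ : cmx Q \in unitmx by have [] := mulmx1_unit QQ.
split.
- by rewrite !unitmx_mul !unitmx_inv uK elim_row_unit // cG uQ.
- by rewrite unitmx_mul unitmx_inv cG elim_col_unit.
- rewrite fiedler_core -!mulmxA [cmx Q *m (cmx Q *m _)]mulmxA QQ mul1mx.
  rewrite (mulKmx cG) (mulKVmx cG) [elim_row _ _ _ *m _]mulmxA elim_core //.
  by rewrite mulKmx.
- rewrite -!mulmxA -!cmx_Ecol -cmxM sgmx_Ecol sign_norm scale1r -G_col_last.
  rewrite cmxM (mulKmx cG) cmx_Ecol elim_row_last //.
  by rewrite -{1}(minor_col_last A qm mq) mulKmx.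
- by rewrite -cmx_Erow -row_last_G cmxM mulmxA mulmxK // cmx_Erow last_elim_col.
Qed.

Hypothesis hevA : T_even A.

Lemma block_T_even : T_even (cmx Q *m fiedler_pencil m A zh w cw czh).
Proof.
have [qc ec em] := index_bounds.
have hev j : (mxcoef A j)^T = (-1) ^+ j *: mxcoef A j by apply: T_even_coef.
rewrite scale_pencil; apply/T_even_pencil; split.
  by apply: L1_sign => //; lia.
by apply: L0_sign => //; lia.
Qed.

Hypothesis n_gt0 : (0 < n)%N.
Hypothesis am : mxcoef A m != 0.

(** The product of the two sign matrices commutes with both coefficients of the
    pencil, and is therefore constant. *)
Lemma block_unique (Q' : 'M[F]_(m * n)) : quasi_identity Q' ->
  T_even (cmx Q' *m fiedler_pencil m A zh w cw czh) -> Q' = Q \/ Q' = - Q.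
Proof.
have [qc ec em] := index_bounds.
move/quasi_identityP => [t ht ->] eQ'; move: block_T_even.
rewrite !scale_pencil in eQ' *; move/T_even_pencil => [s1 s0].
move/T_even_pencil: eQ' => [t1 t0].
have comm (M : 'M[F]_(m * n)) : (sgmx m n t *m M)^T = sgmx m n t *m M ->
    (Q *m M)^T = Q *m M ->
    sgmx m n (fun x => s x * t x) *m M = M *m sgmx m n (fun x => s x * t x).
  rewrite !trmx_mul !tr_sgmx => h1 h2.
  rewrite -sgmxM -mulmxA -h1 mulmxA.
  have -> : Q *m M^T = M *m Q.
    rewrite -[M^T]mulmx1 -(sgmx_sqr m n sign_pm) [M^T *m _]mulmxA h2 !mulmxA.
    by rewrite (sgmx_sqr m n sign_pm) mul1mx.
  by rewrite -mulmxA.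
have comm' (M : 'M[F]_(m * n)) : (sgmx m n t *m M)^T = - (sgmx m n t *m M) ->
    (Q *m M)^T = - (Q *m M) ->
    sgmx m n (fun x => s x * t x) *m M = M *m sgmx m n (fun x => s x * t x).
  rewrite !trmx_mul !tr_sgmx => h1 h2.
  rewrite -sgmxM -mulmxA -[sgmx m n t *m M]opprK -h1 mulmxN mulmxA.
  have -> : Q *m M^T = - (M *m Q).
    rewrite -[M^T]mulmx1 -(sgmx_sqr m n sign_pm) [M^T *m _]mulmxA h2 mulNmx mulmxN.
    by rewrite !mulmxA (sgmx_sqr m n sign_pm) mul1mx.
  by rewrite mulNmx opprK mulmxA.
have cn := connected ec em n_gt0 (comm' _ t1 s1) (comm _ t0 s0) am.
have hs x : s x * s x = 1 by case: (sign_pm x) => ->; rewrite ?mulrNN mulr1.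
have tE x : (x < m)%N -> t x = (s c * t c) * s x.
  by move=> hx; rewrite -(cn x hx) mulrC mulrA hs mul1r.
have : s c * t c = 1 \/ s c * t c = -1.
  by case: (sign_pm c) => ->; case: (ht c) => ->; rewrite ?mulrNN ?mulr1 ?mul1r; auto.
case=> e; [left | right].
  by apply: eq_sgmx => x hx; rewrite tE // e mul1r.
rewrite (@eq_sgmx _ _ _ t (fun x => - s x)).
  by rewrite /sgmx -raddfN; congr diag_mx; apply/rowP=> j; rewrite !mxE.
by move=> x hx; rewrite tE // e mulN1r.
Qed.

End DiagonalBlock.

(** * Assembling the Rosenbrock linearization *)

Section BlockEntries.
Variables (S : comUnitRingType).

Lemma Erow_EcolC (m n x y : nat) : (y < m)%N ->
  Erow S m n x *m Ecol S m n y = (x == y)%:R%:M.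
Proof.
move=> hy; apply: trmx_inj; rewrite trmx_mul trmxK Erow_Ecol // eq_sym.
by rewrite tr_scalar_mx.
Qed.

Lemma mul_ErowE (m n p : nat) (M : 'M[S]_(p, n)) y i (a : 'I_m) (b : 'I_n) :
  (M *m Erow S m n y) i (mxtens_index (a, b)) = (a == y :> nat)%:R * M i b.
Proof.
rewrite mxE (bigD1 b) //= big1 ?addr0 => [|k hk].
  by rewrite mxE mxtens_indexK /= eqxx andbT mulrC.
by rewrite mxE mxtens_indexK /= [b == k]eq_sym (negPf hk) andbF mulr0.
Qed.

Lemma Ecol_mulE (m n p : nat) (M : 'M[S]_(n, p)) y (a : 'I_m) (b : 'I_n) i :
  (Ecol S m n y *m M) (mxtens_index (a, b)) i = (a == y :> nat)%:R * M b i.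
Proof.
rewrite mxE (bigD1 b) //= big1 ?addr0 => [|k hk].
  by rewrite !mxE mxtens_indexK /= eqxx andbT.
by rewrite !mxE mxtens_indexK /= [b == k]eq_sym (negPf hk) andbF mul0r.
Qed.

Lemma Ecol_mul_ErowE (m n k r : nat) (M : 'M[S]_(n, r)) x y
    (a : 'I_m) (b : 'I_n) (c : 'I_k) (d : 'I_r) :
  (Ecol S m n x *m M *m Erow S k r y) (mxtens_index (a, b)) (mxtens_index (c, d))
  = ((a == x :> nat) && (c == y :> nat))%:R * M b d.
Proof.
by rewrite mul_ErowE Ecol_mulE mulrA -natrM mulnb andbC.
Qed.

(** diag(D, I, ..., I) *)
Definition diag_first (k r : nat) (D : 'M[S]_r) : 'M[S]_(k * r) :=
  1%:M + Ecol S k r 0 *m (D - 1%:M) *m Erow S k r 0.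

(** The permutation that exchanges the first and the last block, written as a
    reflection so that it is the identity when these are the same block. *)
Definition swap_ends (k r : nat) : 'M[S]_(k * r) :=
  1%:M - (Ecol S k r 0 - Ecol S k r k.-1) *m (Erow S k r 0 - Erow S k r k.-1).

Lemma swap_ends_col k r : (0 < k)%N ->
  swap_ends k r *m Ecol S k r k.-1 = Ecol S k r 0.
Proof.
move=> hk; rewrite mulmxBl mul1mx -mulmxA [(Erow _ _ _ _ - _) *m _]mulmxBl.
rewrite !Erow_Ecol //; last by lia.
rewrite eqxx; case: (posnP k.-1) => [->|h].
  by rewrite ?eqxx !subrr ?mul0mx ?mulmx0 ?subr0.
rewrite (_ : (0 == k.-1)%N = false) ?raddf0 ?sub0r ?mulmxN ?mulmx1; last by lia.
by rewrite opprK addrC subrK.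
Qed.

Lemma row_swap_ends k r : (0 < k)%N ->
  Erow S k r k.-1 *m swap_ends k r = Erow S k r 0.
Proof.
move=> hk; rewrite mulmxBr mulmx1 mulmxA [_ *m (Ecol _ _ _ _ - _)]mulmxBr.
rewrite !Erow_EcolC //; last by lia.
rewrite eqxx; case: (posnP k.-1) => [->|h].
  by rewrite ?eqxx !subrr ?mul0mx ?mulmx0 ?subr0.
rewrite raddf0 sub0r mulNmx mul1mx.
by rewrite opprK addrC subrK.
Qed.

Lemma swap_ends_sqr k r : (0 < k)%N -> swap_ends k r *m swap_ends k r = 1%:M.
Proof.
move=> hk; rewrite /swap_ends.
set v := Ecol _ _ _ _ - _; set u := Erow _ _ _ _ - _.
have uv : v *m (u *m v) = v + v.
  rewrite /u /v; case: (posnP k.-1) => [->|h]; first by rewrite !subrr mul0mx addr0.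
  have [e1 e2] : (0 == k.-1)%N = false /\ (k.-1 == 0)%N = false by lia.
  have -> : (Erow S k r 0 - Erow S k r k.-1) *m (Ecol S k r 0 - Ecol S k r k.-1)
      = 1%:M + 1%:M.
    rewrite mulmxBl !mulmxBr !Erow_Ecol ?eqxx ?e1 ?e2; try lia.
    by rewrite raddf0 subr0 sub0r opprK.
  by rewrite mulmxDr mulmx1.
have e : v *m u *m (v *m u) = v *m u + v *m u.
  by rewrite -mulmxA [u *m (v *m u)]mulmxA mulmxA uv mulmxDl.
by rewrite mulmxBl mul1mx [X in _ - X]mulmxBr mulmx1 e opprB addrK subrK.
Qed.

Lemma swap_diag_last k r (D : 'M[S]_r) : (0 < k)%N ->
  swap_ends k r *m (1%:M + Ecol S k r k.-1 *m (D - 1%:M) *m Erow S k r k.-1)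
    *m swap_ends k r = diag_first k D.
Proof.
move=> hk; rewrite mulmxDr mulmx1 mulmxDl swap_ends_sqr // !mulmxA.
by rewrite swap_ends_col // -[_ *m Erow _ _ _ _ *m _]mulmxA row_swap_ends.
Qed.

Lemma swap_ends_unit k r : (0 < k)%N -> swap_ends k r \in unitmx.
Proof. by move/(swap_ends_sqr r)/mulmx1_unit => []. Qed.

(** The two splittings of the index set differ in where the last block of A and
    the first block of D are attached. *)
Lemma block_entryP m' n r k' (i : 'I_(m'.+1 * n + k'.+1 * r))
    (e : (m' * n + ((n + r) + k' * r) = m'.+1 * n + k'.+1 * r)%N) :
  [\/ exists2 ab : 'I_m' * 'I_n,
        i = lshift _ (mxtens_index (widen_ord (leqnSn m') ab.1, ab.2)) &
        cast_ord (esym e) i = lshift _ (mxtens_index ab),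
      exists2 b : 'I_n, i = lshift _ (mxtens_index (ord_max, b)) &
        cast_ord (esym e) i = rshift _ (lshift _ (lshift _ b)),
      exists2 b : 'I_r, i = rshift _ (mxtens_index (ord0, b)) &
        cast_ord (esym e) i = rshift _ (lshift _ (rshift _ b)) |
      exists2 ab : 'I_k' * 'I_r,
        i = rshift _ (mxtens_index (lift ord0 ab.1, ab.2)) &
        cast_ord (esym e) i = rshift _ (rshift _ (mxtens_index ab))].
Proof.
case: (split_ordP i) => j ->; case: (mxtens_indexP j) => a b.
- case: (ltnP a m') => ha; [constructor 1|constructor 2].
    exists (Ordinal ha, b); last by apply: val_inj.
    by congr (lshift _ (mxtens_index (_, _))); apply: val_inj.
  have ea : a = ord_max by apply: val_inj => /=; have := ltn_ord a; lia.
  by exists b; rewrite ea //; apply: val_inj.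
- case: (unliftP ord0 a) => [a' ->|->]; [constructor 4|constructor 3].
    exists (a', b) => //; apply: val_inj => /=.
    by rewrite /bump /= add1n !mulSn; lia.
  exists b => //; apply: val_inj => /=; rewrite mulSn; lia.
Qed.

Lemma rosenbrock_layout m' n r k' (A : 'M[S]_n) (B : 'M[S]_(n, r))
    (B' : 'M[S]_(r, n)) (D : 'M[S]_r)
    (e : (m' * n + ((n + r) + k' * r) = m'.+1 * n + k'.+1 * r)%N) :
  block_mx (1%:M + Ecol S m'.+1 n m' *m (A - 1%:M) *m Erow S m'.+1 n m')
    (Ecol S m'.+1 n m' *m B *m Erow S k'.+1 r 0)
    (Ecol S k'.+1 r 0 *m B' *m Erow S m'.+1 n m')
    (diag_first k'.+1 D)
  = castmx (e, e) (block_mx (1%:M : 'M_(m' * n)) 0 0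
      (block_mx (block_mx A B B' D) 0 0 (1%:M : 'M_(k' * r)))).
Proof.
apply/matrixP=> i j; rewrite castmxE.
have ord_ne (p : nat) (u : 'I_p) : (nat_of_ord u == p) = false.
  by rewrite ltn_eqF.
have E1 p q (u v : 'I_p) (b d : 'I_q) : (1%:M : 'M[S]_(p * q))
    (mxtens_index (u, b)) (mxtens_index (v, d)) = ((u == v) && (b == d))%:R.
  by rewrite mxE (can_eq (@mxtens_indexK _ _)) xpair_eqE.
have DE p q x (X : 'M[S]_q) (u v : 'I_p) (b d : 'I_q) :
    (1%:M + Ecol S p q x *m (X - 1%:M) *m Erow S p q x)
      (mxtens_index (u, b)) (mxtens_index (v, d)) =
    if (u == x :> nat) && (v == x :> nat) then X b d
    else ((u == v) && (b == d))%:R.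
  rewrite [LHS]mxE E1 Ecol_mul_ErowE.
  case: ifP => [/andP[/eqP eu /eqP ev]|_]; last by rewrite mul0r addr0.
  have -> : u = v by apply: val_inj; rewrite /= eu ev.
  by rewrite eqxx mul1r !mxE addrC subrK.
rewrite /diag_first.
case: (block_entryP i e) => [] [x -> ->]; case: (block_entryP j e) => [] [y -> ->];
rewrite ?(block_mxEul, block_mxEur, block_mxEdl, block_mxEdr) ?DE ?Ecol_mul_ErowE
  ?[in RHS]mxE /= ?ord_ne ?eqxx ?mul0r ?andbF ?mul1r //.
- rewrite (can_eq (@mxtens_indexK _ _)) [in RHS](surjective_pairing x).
  by rewrite [in RHS](surjective_pairing y) xpair_eqE.
- by rewrite /= -val_eqE /= ord_ne.
- by rewrite -val_eqE /= eq_sym ord_ne.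
- rewrite (can_eq (@mxtens_indexK _ _)) (inj_eq lift_inj).
  by rewrite [in RHS](surjective_pairing x) [in RHS](surjective_pairing y) xpair_eqE.
Qed.

Lemma rosenbrock_layout_pos m n r k (A : 'M[S]_n) (B : 'M[S]_(n, r))
    (B' : 'M[S]_(r, n)) (D : 'M[S]_r)
    (e : (m.-1 * n + ((n + r) + k.-1 * r) = m * n + k * r)%N) :
  (0 < m)%N -> (0 < k)%N ->
  block_mx (1%:M + Ecol S m n m.-1 *m (A - 1%:M) *m Erow S m n m.-1)
    (Ecol S m n m.-1 *m B *m Erow S k r 0)
    (Ecol S k r 0 *m B' *m Erow S m n m.-1) (diag_first k D)
  = castmx (e, e) (block_mx (1%:M : 'M_(m.-1 * n)) 0 0
      (block_mx (block_mx A B B' D) 0 0 (1%:M : 'M_(k.-1 * r)))).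
Proof.
by case: m e => [//|m'] + _; case: k => [//|k'] e _; apply: rosenbrock_layout.
Qed.

End BlockEntries.

Lemma offdiag_block (F : fieldType) (m n k r x y : nat) (B : 'M[F]_(n, r)) :
  cmx ((ecol F m x.+1 *m (ecol F k y.+1)^T) *t B) =
  Ecol {poly F} m n x *m cmx B *m Erow {poly F} k r y.
Proof.
apply/matrixP=> i j; case: (mxtens_indexP i) => a b; case: (mxtens_indexP j) => c d.
rewrite Ecol_mul_ErowE mxE tensmxE mxE big_ord1 !mxE !eqSS -natrM mulnb.
by case: andP => _; rewrite ?mul1r ?mul0r.
Qed.

(** Nothing in the argument is special to the complex numbers. *)
Theorem T_even_rosenbrock (F : fieldType) (n r m k : nat)
    (G : 'M[{fraction {poly F}}]_r)
    (A : 'M[{poly F}]_n) (B : 'M[F]_(n, r)) (D : 'M[{poly F}]_r)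
    (hreg : regular A) (hdegA : mxdegree A m) (hdegD : mxdegree D k)
    (hevA : T_even A) (hevD : T_even D) (hG : realization G A B D)
    (h l : nat) (hh : (h < m)%N) (hheven : ~~ odd h)
    (hl : (l < k)%N) (hleven : ~~ odd l)
    (w v zh zl : seq int) (qw qv qh ql : nat)
    (hw : simple_admissible h w qw)
    (hzh : admissible (m - h - 1) (shift zh m%:Z) qh)
    (hv : simple_admissible l v qv)
    (hzl : admissible (k - l - 1) (shift zl k%:Z) ql) :
  let cw := symm_compl h qw in
  let czh := shift (symm_compl (m - h - 1) qh) (- m%:Z) in
  let cv := symm_compl l qv in
  let czl := shift (symm_compl (k - l - 1) ql) (- k%:Z) in
  let LA := fiedler_pencil m A zh w cw czh in
  let LD := fiedler_pencil k D zl v cv czl in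
  let L QA QD := ros_pencil B w cw v cv QA LA QD LD in
  exists (QA : 'M[F]_(m * n)) (QD : 'M[F]_(k * r)),
    [/\ quasi_identity QA /\ quasi_identity QD,
        T_even (L QA QD),
        forall (QA' : 'M[F]_(m * n)) (QD' : 'M[F]_(k * r)),
          quasi_identity QA' -> quasi_identity QD' -> T_even (L QA' QD') ->
          (QA' = QA \/ QA' = - QA) /\ (QD' = QD \/ QD' = - QD) &
        (mxcoef A m \notin unitmx -> qh = 0%N) ->
        (mxcoef D k \notin unitmx -> ql = 0%N) ->
        rosenbrock_linearization G A B D (L QA QD)].
Proof.
move=> cw czh cv czl LA LD L.
have m0 : (0 < m)%N := leq_ltn_trans (leq0n h) hh.
have k0 : (0 < k)%N := leq_ltn_trans (leq0n l) hl.
have size_gt0 p (P : 'M[{poly F}]_p) d : mxdegree P d -> (0 < p)%N.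
  case=> _; case: p P => [|p] // P; rewrite (_ : mxcoef P d = 0) ?eqxx //.
  by apply/matrixP => - [].
have n_gt0 := size_gt0 _ _ _ hdegA; have r_gt0 := size_gt0 _ _ _ hdegD.
have [hA am] := hdegA; have [hD dk] := hdegD.
have [iw ciw] := zero_runs hheven hw; have [iv civ] := zero_runs hleven hv.
rewrite -/cw in ciw; rewrite -/cv in civ.
set x := (m - 1 - (0 < h)%N)%N; set y := (k - 1 - (0 < l)%N)%N.
have ex : (m - (0 < h)%N)%N = x.+1.
  by rewrite /x; lia.
have ey : (k - (0 < l)%N)%N = y.+1.
  by rewrite /y; lia.
have LE QA QD : L QA QD = block_mx (cmx QA *m LA)
    (Ecol {poly F} m n x *m cmx B *m Erow {poly F} k r y)
    (Ecol {poly F} k r y *m cmx B^T *m Erow {poly F} m n x)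
    (cmx QD *m LD).
  by rewrite /L /ros_pencil iw ciw iv civ ex ey !offdiag_block.
have evE QA QD : T_even (L QA QD) <->
    T_even (cmx QA *m LA) /\ T_even (cmx QD *m LD).
  have cmx_even p q (M : 'M[F]_(p, q)) :
      map_mx (fun P => P \Po - 'X) (cmx M) = cmx M.
    by apply/matrixP=> u z; rewrite !mxE comp_polyC.
  rewrite LE -cmx_Ecol -cmx_Erow -!cmxM.
  rewrite -cmx_Ecol -cmx_Erow -!cmxM.
  rewrite /T_even map_block_mx tr_block_mx !cmx_even !tr_cmx.
  rewrite !trmx_mul !trmxK !mulmxA.
  split=> [/eq_block_mx[]|[-> ->]] //.
pose sA := pencil_sign F qh (m - h - 1) (sign_offset m h qh).
pose sD := pencil_sign F ql (k - l - 1) (sign_offset k l ql).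
exists (sgmx m n sA), (sgmx k r sD).
split.
- by split; apply/quasi_identityP; [exists sA | exists sD] => // z; apply: sign_pm.
- by apply/evE; split; apply: block_T_even.
- move=> QA QD qA qD /evE[eA eD].
  by split; [apply: block_unique qA eA | apply: block_unique qD eD].
move=> aq dq; split=> //.
  have coef_cmx p q (M : 'M[F]_(p, q)) j : (1 < j)%N -> mxcoef (cmx M) j = 0.
    move=> j1; apply/matrixP=> a b; rewrite !mxE /= coefC gtn_eqF //.
    exact: ltnW.
  move=> j j1; rewrite LE -cmx_Ecol -cmx_Erow -!cmxM -cmx_Ecol -cmx_Erow -!cmxM.
  rewrite /mxcoef map_block_mx -!/(mxcoef _ j) !coef_cmx // !scale_pencil //.
  rewrite !pencil_coef !gtn_eqF //; last exact: ltnW.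
  by rewrite !scale0r !subrr block_mx0.
have [U [V [uU uV eUV eU eV]]] := block_linearization hh hheven hw hzh hA aq.
have [U' [V' [uU' uV' eUV' eU' eV']]] := block_linearization hl hleven hv hzl hD dq.
exists U, V, (swap_ends _ k r *m U'), (V' *m swap_ends _ k r).
have uS := swap_ends_unit {poly F} r k0.
split; rewrite ?unitmx_mul ?uS ?uU ?uV ?uU' ?uV' //.
have e : (m.-1 * n + ((n + r) + k.-1 * r) = m * n + k * r)%N.
  rewrite -{2}(prednK m0) -{2}(prednK k0) !mulSn.
  by rewrite !addnA [(_ * n + n)%N]addnC.
exists e; rewrite -rosenbrock_layout_pos //.
rewrite LE !mulmx_block !mul0mx !mulmx0 !addr0 !add0r.
congr block_mx.
- exact: eUV.
- rewrite !mulmxA eU -!mulmxA; congr (_ *m (_ *m _)).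
  by rewrite mulmxA eV' row_swap_ends.
- rewrite !mulmxA -(mulmxA _ U') eU' swap_ends_col // -!mulmxA.
  by congr (_ *m (_ *m _)).
- rewrite -swap_diag_last // -/(diag_last k D) -eUV' !mulmxA //.
Qed.

Theorem theorem3p11 (R : realType) (n r m k : nat)
    (G : 'M[{fraction {poly R[i]}}]_r)
    (A : 'M[{poly R[i]}]_n) (B : 'M[R[i]]_(n, r)) (D : 'M[{poly R[i]}]_r)
    (hreg : regular A) (hdegA : mxdegree A m) (hdegD : mxdegree D k)
    (hevA : T_even A) (hevD : T_even D) (hG : realization G A B D)
    (h l : nat) (hh : (h < m)%N) (hheven : ~~ odd h)
    (hl : (l < k)%N) (hleven : ~~ odd l)
    (w v zh zl : seq int) (qw qv qh ql : nat)
    (hw : simple_admissible h w qw)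
    (hzh : admissible (m - h - 1) (shift zh m%:Z) qh)
    (hv : simple_admissible l v qv)
    (hzl : admissible (k - l - 1) (shift zl k%:Z) ql) :
  let cw := symm_compl h qw in
  let czh := shift (symm_compl (m - h - 1) qh) (- m%:Z) in
  let cv := symm_compl l qv in
  let czl := shift (symm_compl (k - l - 1) ql) (- k%:Z) in
  let LA := fiedler_pencil m A zh w cw czh in
  let LD := fiedler_pencil k D zl v cv czl in
  let L QA QD := ros_pencil B w cw v cv QA LA QD LD in
  exists (QA : 'M[R[i]]_(m * n)) (QD : 'M[R[i]]_(k * r)),
    [/\ quasi_identity QA /\ quasi_identity QD,
        T_even (L QA QD),
        (* uniqueness, necessarily up to the signs of QA and of QD *)
        forall (QA' : 'M[R[i]]_(m * n)) (QD' : 'M[R[i]]_(k * r)),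
          quasi_identity QA' -> quasi_identity QD' -> T_even (L QA' QD') ->
          (QA' = QA \/ QA' = - QA) /\ (QD' = QD \/ QD' = - QD) &
        (mxcoef A m \notin unitmx -> qh = 0%N) ->
        (mxcoef D k \notin unitmx -> ql = 0%N) ->
        rosenbrock_linearization G A B D (L QA QD)].
Proof. exact: (T_even_rosenbrock (F := R[i])). Qed.
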